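(* Let $q,r\ge2$ be integers, $b=qr$, $\mu=\mu_{q,b}$, and let $\tau$ be a maximal mapping that is irregular on only finitely many elements of $\Gamma_q$, say exactly on $I_10^\infty,\dots,I_N0^\infty$ with $N\ge1$, where each $I_i\in\Sigma_q^*$ is a nonempty word whose last letter is non-zero. Let $\tau_R$ be the corresponding regularized mapping $$\tau_R(\sigma)=\begin{cases}0,&\text{if }\sigma=I_i0^k\text{ for some }i\in\{1,\dots,N\}\text{ and }k\ge1,\\ \tau(\sigma),&\text{otherwise.}\end{cases}$$ Then $\tau$ is a spectral mapping if and only if $\tau_R$ is a spectral mapping.
   Context: $\mu_{q,b}$ is the unique Borel probability measure $\mu$ on $\mathbb{R}$ satisfying $\mu(E)=\sum_{i=0}^{q-1}\frac1q\,\mu(f_i^{-1}(E))$ for all Borel $E$, where $f_i(x)=b^{-1}(x+i)$. A countable set $\Lambda\subset\mathbb{R}$ is a spectrum of $L^2(\mu)$ if $\{e^{2\pi i\lambda x}:\lambda\in\Lambda\}$ is an orthonormal basis of $L^2(\mu)$. Words: $\Sigma_q=\{0,\dots,q-1\}$; $\Sigma_q^n$ is the set of words of length $n$; $\Sigma_q^0=\{\vartheta\}$ with $\vartheta$ the empty word; $\Sigma_q^*=\bigcup_{n\ge0}\Sigma_q^n$. For a finite or infinite word $\sigma=\sigma_1\sigma_2\cdots$, $\sigma|_k=\sigma_1\cdots\sigma_k$. Juxtaposition is concatenation, $0^k$ is the word of $k$ zeros, $0^\infty=000\cdots$. $\Gamma_q=\{\sigma0^\infty:\sigma=\sigma_1\cdots\sigma_k\in\Sigma_q^*,\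 \sigma_k\ne0\}$, where $\sigma=\vartheta$ is allowed, so $0^\infty\in\Gamma_q$. Let $\mathcal{C}=\{-1,0,1,\dots,b-2\}$ and $\mathcal{C}_i=(i+q\mathbb{Z})\cap\mathcal{C}$ for $i=0,\dots,q-1$. A map $\tau:\Sigma_q^*\to\mathcal{C}$ is regular on $\sigma\in\Gamma_q$ if $\tau(\sigma|_k)=0$ for all sufficiently large $k$, and irregular on $\sigma$ otherwise. The map $\tau$ is a maximal mapping if: (i) $\tau(\vartheta)=\tau(0^n)=0$ for all $n\ge1$; (ii) $\tau(\sigma_1\cdots\sigma_k)\in\mathcal{C}_{\sigma_k}$ for all $k\ge1$ and $\sigma_1\cdots\sigma_k\in\Sigma_q^k$; (iii) for any $\sigma\in\Sigma_q^*$ there exists $\sigma'\in\Sigma_q^*$ such that $\tau$ is regular on $\sigma\sigma'0^\infty$. If $\tau$ is regular on $\sigma\in\Gamma_q$, put $\Pi^\tau_b(\sigma)=\sum_{k=1}^\infty\tau(\sigma|_k)b^{k-1}$, and let $\Lambda(\tau)=\{\Pi^\tau_b(\sigma):\sigma\in\Gamma_q,\ \tau\text{ is regular on }\sigma\}$. A maximal mapping $\tau$ is a spectral mapping if $r\Lambda(\tau)=\{r\lambda:\lambda\in\Lambda(\tau)\}$ is a spectrum of $L^2(\mu_{q,b})$. *)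

(* Defs.v *)
From HB Require Import structures.
From mathcomp Require Export all_boot all_order all_algebra.
From mathcomp Require Export all_classical all_reals all_analysis.
From mathcomp Require Export complex.

Export Order.TTheory GRing.Theory Num.Theory.
Export numFieldNormedType.Exports.

Set Implicit Arguments.
Unset Strict Implicit.
Unset Printing Implicit Defensive.

Local Open Scope classical_set_scope.
Local Open Scope ring_scope.

Section ComplexL2.
Context (R : realType) (d : measure_display) (T : measurableType d)
  (mu : {measure set T -> \bar R}).
Implicit Types f g : T -> R[i].

Definition L2 f : Prop :=
  [/\ measurable_fun setT (fun x => complex.Re (f x)),
      measurable_fun setT (fun x => complex.Im (f x))
    & (\int[mu]_x ((ComplexField.Normc.normc (f x) ^+ 2)%:E) < +oo)%E].

Definition cintegral f : R[i] :=
  Complex (\int[mu]_x complex.Re (f x)) (\int[mu]_x complex.Im (f x)).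

Definition inner f g : R[i] := cintegral (fun x => f x * conjc (g x)).

(* Orthonormal basis in the Hilbert space sense: an orthonormal family whose
   finite linear combinations are dense for the L^2-norm. *)
Definition orthonormal_basis (J : eqType) (L : set J) (e : J -> T -> R[i]) :
    Prop :=
  [/\ (forall j, L j -> L2 (e j)),
      (forall j k, L j -> L k -> inner (e j) (e k) = (j == k)%:R)
    & (forall f, L2 f -> forall eps : R, 0 < eps ->
        exists (n : nat) (j : 'I_n -> J) (c : 'I_n -> R[i]),
          (forall i, L (j i)) /\
          (\int[mu]_x
             ((ComplexField.Normc.normc (f x - \sum_(i < n) c i * e (j i) x) ^+ 2)%:E)
           < (eps ^+ 2)%:E)%E)].

End ComplexL2.

Definition expi2pi (R : realType) (l : R) (x : measurableTypeR R) : R[i] :=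
  Complex (cos (2 * pi * l * x)) (sin (2 * pi * l * x)).

Definition is_spectrum (R : realType)
    (mu : {measure set (measurableTypeR R) -> \bar R}) (L : set R) : Prop :=
  countable L /\ orthonormal_basis mu L (@expi2pi R).

Definition ifs_map (R : realType) (b i : nat) (x : measurableTypeR R) :
    measurableTypeR R :=
  b%:R^-1 * (x + i%:R).

(* Among probability measures this equation has exactly one solution when
   [0 < q] and [1 < b], namely mu_{q,b}. *)
Definition self_similar (R : realType) (q b : nat)
    (mu : set (measurableTypeR R) -> \bar R) : Prop :=
  forall E : set (measurableTypeR R), measurable E ->
    mu E = (\sum_(i < q)
      (q%:R^-1)%:E * mu (ifs_map b i @^-1` E))%E.

Definition word (q : nat) := seq 'I_q.
(* Infinite words are indexed from 0: the letter sigma_k is [s k.-1]. *)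
Definition iword (q : nat) := nat -> 'I_q.

Section MaximalMappings.
Context (q : nat) (hq : (1 < q)%N).

Definition letter0 : 'I_q := Ordinal (ltnW hq).

Definition zeros (k : nat) : word q := nseq k letter0.

(* The infinite word w 0^oo. *)
Definition pad0 (w : word q) : iword q := nth letter0 w.

Definition iprefix (s : iword q) (k : nat) : word q := mkseq s k.

Definition last_nonzero (w : word q) : Prop := last letter0 w <> letter0.

Definition Gamma : set (iword q) :=
  [set s | exists w : word q, (w = [::] \/ last_nonzero w) /\ s = pad0 w].

Definition digits (b : nat) : set int := [set z | -1 <= z <= b%:Z - 2].

Definition digits_of (b : nat) (i : 'I_q) : set int :=
  [set z | exists m : int, z = (i : nat)%:Z + q%:Z * m] `&` digits b.

Definition regular_on (tau : word q -> int) (s : iword q) : Prop :=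
  \forall k \near \oo, tau (iprefix s k) = 0.

Definition maximal_mapping (b : nat) (tau : word q -> int) : Prop :=
  [/\ (forall w, digits b (tau w)),
      (tau [::] = 0 /\ forall n, (1 <= n)%N -> tau (zeros n) = 0),
      (forall (w : word q) (a : 'I_q), digits_of b a (tau (rcons w a)))
    & (forall w : word q, exists w' : word q, regular_on tau (pad0 (w ++ w')))].

Definition Pi_map (R : realType) (b : nat) (tau : word q -> int)
    (s : iword q) : R :=
  limn (fun n => \sum_(1 <= k < n)
                   ((tau (iprefix s k))%:~R * b%:R ^+ k.-1 : R)).

Definition Lambda (R : realType) (b : nat) (tau : word q -> int) : set R :=
  [set Pi_map R b tau s | s in [set s | Gamma s /\ regular_on tau s]].

Definition spectral_mapping (R : realType) (b r : nat)
    (mu : {measure set (measurableTypeR R) -> \bar R})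
    (tau : word q -> int) : Prop :=
  maximal_mapping b tau /\
  is_spectrum mu [set r%:R * l | l in (Lambda b tau : set R)].

Definition regularized (N : nat) (I : 'I_N -> word q) (tau : word q -> int) :
    word q -> int :=
  fun w => if `[< exists (i : 'I_N) (k : nat),
                    (1 <= k)%N /\ w = I i ++ zeros k >]
           then 0 else tau w.

End MaximalMappings.

(* Main.v *)
Require Import Defs.
From mathcomp Require Import measurable_realfun ring lra zify.
Local Open Scope classical_set_scope.
Local Open Scope ring_scope.
Set Implicit Arguments.
Unset Strict Implicit.

(** Put b = q r and e(x) = exp(2 pi i x), and let p be the squared modulus of
    the mask q^-1 (1 + e(x) + ... + e((q-1) x)).  Self-similarity of mu makes
    its Fourier transform phi satisfy |phi(x)|^2 = p(x/b) |phi(x/b)|^2, so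
    |phi(x)|^2 is the infinite product of the p(x/b^j).

    A mapping t turns this product into a random walk on the tree of words.
    At a node with point x the letter a is chosen with probability p(x_a),
    where x_a = (x + r t(a))/b is the point of the child; these numbers add up
    to 1 because t(a) is congruent to a modulo q ([mask_push_sum]).  Follow a
    branch s ending in zeros.  If t is regular on s, the probability of s is
    |phi(x + r Pi(s))|^2, the squared coefficient of e_(-x) along the
    exponential of frequency r Pi(s).  If t is irregular on s, infinitely many
    factors stay below a constant c < 1, and s has probability 0
    ([spine_irregular]).  Exponentials with frequencies in r Lambda(t) are
    orthonormal, so e_(-x) lies in their closed span exactly when the walk
    started at x ends in zeros almost surely ([approx_total],
    [total_approx]).  Call t full if this happens for all irrational x.

    Irrational points are well behaved: x -> x_a permutes them and p does not
    vanish there.  Hence t is full if and only if all its subtrees are, at any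
    level, with no exceptional points to carry along ([full_subtree],
    [full_level]).  Moreover the values of t along the branch 0^oo do not
    affect fullness: the probability of staying on this branch for n steps
    decreases to the probability of the branch itself, so t is full as soon as
    all subtrees hanging off 0^oo are ([full_off_spine]).  Below a level
    exceeding the lengths of all I_i, tau and its regularization differ only
    along branches 0^oo of subtrees; therefore tau is full if and only if its
    regularization is ([full_regularized]).

    It remains to return to L^2 ([spectrum_transfer]).  If r Lambda(t) is a
    spectrum, then t is full.  If a second mapping t' is then full as well,
    every e_x with x irrational is in the closed span of its exponentials, and
    letting x tend to an integer so is every e_x with x an integer.  In
    particular this closed span contains the exponentials attached to t, which
    span L^2. *)

(** * The mask polynomial *)

Lemma ord_eq_dvdz {q : nat} (a a' : 'I_q) :
  (q%:Z %| (a : nat)%:Z - (a' : nat)%:Z)%Z -> a = a'.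
Proof.
move=> /dvdzP[z e]; apply: ord_inj; have := ltn_ord a; have := ltn_ord a'.
have [z0|[z1|z1]] : z = 0 \/ 1 <= z \/ z <= -1 by lia.
- by rewrite z0 in e; lia.
- have : 1 * q%:Z <= z * q%:Z by rewrite ler_wpM2r.
  by lia.
- have : z * q%:Z <= -1 * q%:Z by rewrite ler_wpM2r.
  by lia.
Qed.

Section Mask.
Context {R : realType}.
Implicit Types (x y t : R) (z : R[i]).

Definition nsq z : R := ComplexField.Normc.normc z ^+ 2.

Lemma nsqE z : nsq z = complex.Re z ^+ 2 + complex.Im z ^+ 2.
Proof. by case: z => a b; rewrite /nsq /= sqr_sqrtr// addr_ge0 ?sqr_ge0. Qed.

Lemma nsqC z : (nsq z)%:C%C = z * conjc z.
Proof. by rewrite nsqE; case: z => a b; apply/eqP; rewrite eq_complex /=; apply/andP; split; apply/eqP; ring. Qed.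

Lemma nsqM z1 z2 : nsq (z1 * z2) = nsq z1 * nsq z2.
Proof. by rewrite /nsq ComplexField.Normc.normcM exprMn. Qed.

Lemma nsqJ z : nsq (conjc z) = nsq z.
Proof. by rewrite !nsqE; case: z => a b /=; rewrite sqrrN. Qed.

Lemma nsq_ge0 z : 0 <= nsq z.
Proof. exact: sqr_ge0. Qed.

Lemma nsq_eq0 z : nsq z = 0 -> z = 0.
Proof. by move/eqP; rewrite sqrf_eq0 => /eqP /ComplexField.Normc.eq0_normc. Qed.

Lemma nsq0 : nsq 0 = 0.
Proof. by rewrite nsqE /= expr0n addr0. Qed.

Lemma ReD z1 z2 : complex.Re (z1 + z2) = complex.Re z1 + complex.Re z2.
Proof. by case: z1 z2 => ? ? []. Qed.

Lemma ImD z1 z2 : complex.Im (z1 + z2) = complex.Im z1 + complex.Im z2.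
Proof. by case: z1 z2 => ? ? []. Qed.

Lemma Re_sum (J : Type) (s : seq J) (P : pred J) (F : J -> R[i]) :
  complex.Re (\sum_(j <- s | P j) F j) = \sum_(j <- s | P j) complex.Re (F j).
Proof. exact: (big_morph _ ReD). Qed.

Lemma Im_sum (J : Type) (s : seq J) (P : pred J) (F : J -> R[i]) :
  complex.Im (\sum_(j <- s | P j) F j) = \sum_(j <- s | P j) complex.Im (F j).
Proof. exact: (big_morph _ ImD). Qed.

Definition chi t : R[i] := Complex (cos (2 * pi * t)) (sin (2 * pi * t)).
Arguments chi : simpl never.

Lemma chiD x y : chi (x + y) = chi x * chi y.
Proof.
rewrite /chi mulrDr cosD sinD; apply/eqP; rewrite eq_complex /=.
by apply/andP; split; apply/eqP; ring.
Qed.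

Lemma chi0 : chi 0 = 1.
Proof. by rewrite /chi mulr0 cos0 sin0. Qed.

Lemma chiN x : chi (- x) = conjc (chi x).
Proof. by rewrite /chi mulrN cosN sinN. Qed.

Lemma chiMn x n : chi (x *+ n) = chi x ^+ n.
Proof. by elim: n => [|n IH]; rewrite ?mulr0n ?chi0// mulrS chiD IH exprS. Qed.

Lemma chi1 : chi 1 = 1.
Proof. by rewrite /chi mulr1 mulr_natl cos2pi sin2pi. Qed.

Lemma chi_int (m : int) : chi m%:~R = 1.
Proof.
have chi_nat n : chi n%:R = 1 by rewrite chiMn chi1 expr1n.
by case: m => n; [exact: chi_nat | rewrite NegzE mulrNz chiN chi_nat conjc1].
Qed.

Lemma chiDz x (m : int) : chi (x + m%:~R) = chi x.
Proof. by rewrite chiD chi_int mulr1. Qed.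

Lemma chi_eq1 x : chi x = 1 -> exists m : int, x = m%:~R.
Proof.
move=> cx; exists (Num.floor x); set m := Num.floor x.
have [f0 f1] : 0 <= x - m%:~R /\ x - m%:~R < 1.
  have /andP[m0 m1] := floor_itv x; move: m1; rewrite intrD => m1.
  by rewrite subr_ge0; split=> //; rewrite ltrBlDl.
have : chi (x - m%:~R) = 1 by rewrite -mulrNz chiDz.
move=> [c1 _]; apply/eqP; rewrite -subr_eq0; apply/negPn/negP => n0.
have p0 := @pi_gt0 R.
have : 0 < sin (pi * (x - m%:~R)).
  have fgt0 : 0 < x - m%:~R by rewrite lt_def n0.
  by apply: sin_gt0_pi; rewrite mulr_gt0//= gtr_pMr.
move: c1; rewrite -mulrA mulr_natl cos_mulr2n cos2sin2 => c1.
by move: c1 => + s0; have := exprn_gt0 2 s0; clear -R => ? ?; lra.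
Qed.

Lemma nsq_chi x : nsq (chi x) = 1.
Proof. by rewrite nsqE /chi /= cos2Dsin2. Qed.

Variable q : nat.
Hypothesis q1 : (1 < q)%N.

Definition mask x : R := nsq (q%:R^-1 * \sum_(k < q) chi (k%:R * x)).

Let q0 : q%:R != 0 :> R.
Proof. by rewrite pnatr_eq0; lia. Qed.

Let q0C : q%:R != 0 :> R[i].
Proof. by rewrite pnatr_eq0; lia. Qed.

Lemma mask_ge0 x : 0 <= mask x.
Proof. exact: nsq_ge0. Qed.

Lemma maskDz x (m : int) : mask (x + m%:~R) = mask x.
Proof.
rewrite /mask; congr (nsq (_ * _)); apply: eq_bigr => k _.
rewrite mulrDr (_ : k%:R * m%:~R = (k%:Z * m)%:~R) ?chiDz//.
by rewrite intrM.
Qed.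

Lemma geom_chi x n : (chi x - 1) * (\sum_(k < n) chi (k%:R * x)) = chi (n%:R * x) - 1.
Proof.
rewrite mulr_natl chiMn subrX1; congr (_ * _).
by apply: eq_bigr => k _; rewrite mulr_natl chiMn.
Qed.

Lemma mask_eq0 x : mask x = 0 -> exists m : int, q%:R * x = m%:~R.
Proof.
move=> /nsq_eq0/eqP; rewrite mulf_eq0 invr_eq0 (negbTE q0C)/= => /eqP s0.
have := geom_chi x q; rewrite s0 mulr0 => /esym/eqP; rewrite subr_eq0 => /eqP.
exact: chi_eq1.
Qed.

Lemma sum_chi_eq0 (d : int) : ~ (q%:Z %| d)%Z ->
  \sum_(k < q) chi (k%:R * (d%:~R / q%:R)) = 0.
Proof.
move=> nd; have /eqP := geom_chi (d%:~R / q%:R) q.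
rewrite mulrCA divff// mulr1 chi_int subrr mulf_eq0 subr_eq0 => /orP[|/eqP//].
move=> /eqP/chi_eq1[m dm]; case: nd; apply/dvdzP; exists m.
apply: (@mulrIz R _ _ _ _); first exact: oner_neq0.
by rewrite intrM -dm -mulrA mulVf// mulr1.
Qed.

Lemma mask_int_div (d : int) : ~ (q%:Z %| d)%Z -> mask (d%:~R / q%:R) = 0.
Proof. by move=> nd; rewrite /mask sum_chi_eq0// mulr0 nsq0. Qed.

(** Parseval on the cyclic group of order q: the values of the mask polynomial
    at the x + a/q form the discrete Fourier transform of q numbers of modulus
    1/q. *)
Lemma mask_sum x : \sum_(a < q) mask (x + a%:R / q%:R) = 1.
Proof.
apply: (@complexI R); rewrite rmorph1 rmorph_sum /=.
transitivity (q%:R^-1 * q%:R^-1 * \sum_(k < q) \sum_(l < q)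
    (chi (k%:R * x) * conjc (chi (l%:R * x)) *
     \sum_(a < q) chi (a%:R * ((k%:Z - l%:Z)%:~R / q%:R))) : R[i]).
  rewrite (eq_bigr (fun a : 'I_q => q%:R^-1 * q%:R^-1 * \sum_(k < q) \sum_(l < q)
    (chi (k%:R * x) * conjc (chi (l%:R * x)) *
     chi (a%:R * ((k%:Z - l%:Z)%:~R / q%:R))) : R[i])); last first.
    move=> a _; rewrite [LHS]nsqC rmorphM rmorph_sum fmorphV rmorph_nat mulrACA.
    congr (_ * _); rewrite big_distrlr /=; apply: eq_bigr => k _.
    apply: eq_bigr => l _. rewrite -[X in _ * X = _]chiN -[X in _ * X * _]chiN -!chiD; congr chi.
    rewrite intrB /=; field; exact: q0.
  rewrite -big_distrr /= exchange_big /=; congr (_ * _).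
  apply: eq_bigr => k _; rewrite exchange_big /=; apply: eq_bigr => l _.
  by rewrite big_distrr.
rewrite (eq_bigr (fun=> q%:R)); last first.
  move=> k _; rewrite (bigD1 k isT) [X in _ + X = _]big1 ?addr0; last first.
    move=> l lk; rewrite sum_chi_eq0 ?mulr0//.
    by move=> /ord_eq_dvdz e; rewrite e eqxx in lk.
  rewrite -nsqC nsq_chi rmorph1 mul1r subrr (eq_bigr (fun=> 1)).
    by rewrite sumr_const card_ord.
  by move=> a _; rewrite mul0r mulr0 chi0.
by rewrite sumr_const card_ord -mulr_natl; field.
Qed.

Lemma mask_le1 x : mask x <= 1.
Proof.
rewrite -(mask_sum x) (bigD1 (Ordinal (ltnW q1)))//= mul0r addr0 lerDl.
by apply: sumr_ge0 => *; exact: mask_ge0.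
Qed.

(** Bounds the mask away from 1 wherever its translate by 1/q does not
    vanish, without computing its maxima. *)
Lemma mask_le_shift x : mask x <= 1 - mask (x + q%:R^-1).
Proof.
have := mask_sum x; rewrite (bigD1 (Ordinal (ltnW q1)))//= mul0r addr0.
rewrite (bigD1 (Ordinal q1))//= mul1r => e; rewrite lerBrDr -[leRHS]e lerD2l lerDl.
by apply: sumr_ge0 => *; exact: mask_ge0.
Qed.

Lemma mask_sum_digits x (t : 'I_q -> int) :
  (forall a, exists m : int, t a = (a : nat)%:Z + q%:Z * m) ->
  \sum_(a < q) mask (x + (t a)%:~R / q%:R) = 1.
Proof.
move=> ht; rewrite -[RHS](mask_sum x); apply: eq_bigr => a _.
have [m ->] := ht a; rewrite -[RHS](maskDz _ m) intrD intrM -addrA; congr (mask (_ + _)).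
by rewrite mulrDl (mulrC q%:~R) mulfK.
Qed.

Lemma mask_trigE x : mask x =
  (q%:R^-1 * \sum_(k < q) cos (2 * pi * (k%:R * x))) ^+ 2 +
  (q%:R^-1 * \sum_(k < q) sin (2 * pi * (k%:R * x))) ^+ 2.
Proof.
rewrite /mask nsqM; rewrite !exprMn -mulrDr; congr (_ * _).
  rewrite -[q%:R^-1 in LHS](_ : (q%:R^-1 : R)%:C%C = _); last by rewrite fmorphV rmorph_nat.
  by rewrite nsqE /= expr0n addr0.
rewrite nsqE; congr (_ ^+ 2 + _ ^+ 2).
  by rewrite Re_sum.
by rewrite Im_sum.
Qed.

Lemma continuous_mask : continuous mask.
Proof.
move=> x; rewrite (_ : mask = fun y =>
  (q%:R^-1 * \sum_(k < q) cos (2 * pi * (k%:R * y))) ^+ 2 +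
  (q%:R^-1 * \sum_(k < q) sin (2 * pi * (k%:R * y))) ^+ 2); last first.
  by apply/funext => y; exact: mask_trigE.
have lin k : (fun y : R => 2 * pi * (k%:R * y)) y @[y --> x] --> 2 * pi * (k%:R * x).
  by apply: cvgM; [exact: cvg_cst|apply: cvgM; [exact: cvg_cst|exact: cvg_id]].
have C : (fun y : R => q%:R^-1 * \sum_(k < q) cos (2 * pi * (k%:R * y))) y
    @[y --> x] --> q%:R^-1 * \sum_(k < q) cos (2 * pi * (k%:R * x)).
  apply: cvgM; first exact: cvg_cst.
  by apply: (cvg_big (@add_continuous R)) => k _; exact: (cvg_comp _ _ (lin k) (@continuous_cos R _)).
have S : (fun y : R => q%:R^-1 * \sum_(k < q) sin (2 * pi * (k%:R * y))) y
    @[y --> x] --> q%:R^-1 * \sum_(k < q) sin (2 * pi * (k%:R * x)).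
  apply: cvgM; first exact: cvg_cst.
  by apply: (cvg_big (@add_continuous R)) => k _; exact: (cvg_comp _ _ (lin k) (@continuous_sin R _)).
exact: (cvgD (cvgM C C) (cvgM S S)).
Qed.

(** On (0, 1/q) the translate by 1/q stays between consecutive multiples of
    1/q, where the mask has no zero; compactness gives a uniform bound. *)
Lemma mask_lt1_on x y : 0 < x -> x <= y -> y * q%:R < 1 ->
  exists2 c : R, c < 1 & forall u, x <= u <= y -> mask u <= c.
Proof.
move=> x0 xy yq.
have [|c cI hc] := @EVT_max R mask x y xy.
  by apply: continuous_subspaceT; exact: continuous_mask.
exists (mask c); last by move=> u uI; apply: hc; rewrite in_itv.
move: cI; rewrite in_itv /= => /andP[xc cy].
apply: (le_lt_trans (mask_le_shift c)); rewrite ltrBlDr ltrDl.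
rewrite lt_def mask_ge0 andbT; apply/negP => /eqP /mask_eq0[m].
(* q c lies strictly between 0 and 1, yet q c + 1 should be an integer *)
have qp : 0 < q%:R :> R by rewrite ltr0n; lia.
rewrite mulrDr divff// => e.
have l1 : 0 < q%:R * c by rewrite mulr_gt0//; apply: lt_le_trans xc.
have l2 : q%:R * c < 1 by apply: le_lt_trans yq; rewrite mulrC ler_pM2r.
have : (1%:~R : R) < m%:~R by rewrite -e; lra.
have : (m%:~R : R) < 2%:~R by rewrite -e; lra.
rewrite !ltr_int; lia.
Qed.

End Mask.

(** * Integration of complex functions *)
Section ComplexIntegral.
Context {R : realType} {d : measure_display} {T : measurableType d}
  (mu : {measure set T -> \bar R}).
Implicit Types (f g : T -> R[i]) (c : R[i]).

Definition cintegrable f : Prop :=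
  mu.-integrable setT (EFin \o (fun x => complex.Re (f x))) /\
  mu.-integrable setT (EFin \o (fun x => complex.Im (f x))).

Lemma cintegrableD f g : cintegrable f -> cintegrable g ->
  cintegrable (fun x => f x + g x).
Proof.
move=> [fr fi] [gr gi]; split.
  apply: eq_integrable (integrableD measurableT fr gr) => //= x _.
  by rewrite ReD.
apply: eq_integrable (integrableD measurableT fi gi) => //= x _.
by rewrite ImD.
Qed.

Lemma cintegralD f g : cintegrable f -> cintegrable g ->
  cintegral mu (fun x => f x + g x) = cintegral mu f + cintegral mu g.
Proof.
move=> [fr fi] [gr gi]; rewrite /cintegral; apply/eqP; rewrite eq_complex /=.
under eq_Rintegral do rewrite ReD.
under [X in _ && (X == _)]eq_Rintegral do rewrite ImD.
by rewrite !RintegralD// !eqxx.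
Qed.

Lemma ReM c1 c2 : complex.Re (c1 * c2) =
  complex.Re c1 * complex.Re c2 - complex.Im c1 * complex.Im c2 :> R.
Proof. by case: c1 c2 => ? ? []. Qed.

Lemma ImM c1 c2 : complex.Im (c1 * c2) =
  complex.Re c1 * complex.Im c2 + complex.Im c1 * complex.Re c2 :> R.
Proof. by case: c1 c2 => ? ? []. Qed.

Lemma cintegrableZ c f : cintegrable f -> cintegrable (fun x => c * f x).
Proof.
move=> [fr fi]; split.
  apply: eq_integrable (integrableB measurableT (integrableZl measurableT (complex.Re c) fr)
    (integrableZl measurableT (complex.Im c) fi)) => //= x _.
  by rewrite ReM.
apply: eq_integrable (integrableD measurableT (integrableZl measurableT (complex.Re c) fi)
    (integrableZl measurableT (complex.Im c) fr)) => //= x _.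
by rewrite ImM.
Qed.

Lemma cintegralZ c f : cintegrable f ->
  cintegral mu (fun x => c * f x) = c * cintegral mu f.
Proof.
move=> [fr fi]; rewrite /cintegral; apply/eqP; rewrite eq_complex.
rewrite ReM ImM /=.
under eq_Rintegral do rewrite ReM.
under [X in _ && (X == _)]eq_Rintegral do rewrite ImM.
have Z s h : mu.-integrable setT (EFin \o h) ->
    mu.-integrable setT (EFin \o (fun x => s * h x)).
  by move=> hi; apply: eq_integrable (integrableZl measurableT s hi).
by rewrite RintegralB ?RintegralD ?RintegralZl ?eqxx//; exact: Z.
Qed.

Lemma cintegrable0 : cintegrable (fun=> 0).
Proof. by split; exact: integrable0. Qed.

Lemma cintegral0 : cintegral mu (fun=> 0) = 0.
Proof.
rewrite /cintegral /=.
by rewrite !Rintegral_cst// mul0r.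
Qed.

Lemma cintegrable_sum (J : Type) (s : seq J) (f : J -> T -> R[i]) :
  (forall j, cintegrable (f j)) -> cintegrable (fun x => \sum_(j <- s) f j x).
Proof.
move=> hf; elim: s => [|j s IH].
  by under [X in cintegrable X]eq_fun do rewrite big_nil; exact: cintegrable0.
under [X in cintegrable X]eq_fun do rewrite big_cons.
exact: cintegrableD.
Qed.

Lemma cintegral_sum (J : Type) (s : seq J) (f : J -> T -> R[i]) :
  (forall j, cintegrable (f j)) ->
  cintegral mu (fun x => \sum_(j <- s) f j x) = \sum_(j <- s) cintegral mu (f j).
Proof.
move=> hf; elim: s => [|j s IH].
  by under [X in cintegral _ X]eq_fun do rewrite big_nil; rewrite cintegral0 big_nil.
under [X in cintegral _ X]eq_fun do rewrite big_cons.
by rewrite cintegralD ?IH ?big_cons//; exact: cintegrable_sum.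
Qed.

Lemma integral_nsq f : cintegrable (fun x => f x * conjc (f x)) ->
  (\int[mu]_x (nsq (f x))%:E =
   (complex.Re (cintegral mu (fun x => f x * conjc (f x))))%:E)%E.
Proof.
move=> [fr _]; rewrite /cintegral /= /Rintegral fineK ?integrable_fin_num//.
by apply: eq_integral => x _; rewrite -nsqC.
Qed.

End ComplexIntegral.

(** * The Fourier transform of a self-similar measure *)
Lemma continuous_ifs_map (R : realType) (b i : nat) :
  continuous (@ifs_map R b i : R -> R).
Proof.
move=> x; apply: cvgM; first exact: cvg_cst.
by apply: cvgD; [exact: cvg_id | exact: cvg_cst].
Qed.

Lemma measurable_ifs_map (R : realType) (b i : nat) :
  measurable_fun setT (@ifs_map R b i).
Proof. by apply: continuous_measurable_fun; exact: continuous_ifs_map. Qed.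

Section Fourier.
Context {R : realType} (mu : probability (measurableTypeR R) R).

Lemma Rintegral_const (c : R) : \int[mu]_x c = c.
Proof.
rewrite Rintegral_cst// -[RHS]mulr1 -[1]/(fine 1%:E); congr (_ * fine _).
exact: probability_setT.
Qed.

Lemma bounded_continuous_integrable (f : R -> R) (M : R) :
  continuous f -> (forall x, `|f x| <= M) -> mu.-integrable setT (EFin \o f).
Proof.
move=> cf fM; apply: measurable_bounded_integrable => //.
- by apply: (le_lt_trans (probability_le1 mu measurableT)); exact: ltry.
- exact: continuous_measurable_fun.
- exists M; split; first exact: num_real.
  by move=> N MN x _; apply: le_trans (fM x) (ltW MN).
Qed.

Lemma continuous_wave (f : R -> R) (t : R) : continuous f ->
  continuous (fun x => f (2 * pi * (t * x))).
Proof.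
move=> cf x.
have lin : 2 * pi * (t * y) @[y --> x] --> 2 * pi * (t * x).
  by apply: cvgM; [exact: cvg_cst | apply: cvgM; [exact: cvg_cst | exact: cvg_id]].
exact: (cvg_comp _ _ lin (cf _)).
Qed.

Lemma integrable_wave (f : R -> R) (t : R) : continuous f ->
  (forall x, `|f x| <= 1) ->
  mu.-integrable setT (EFin \o (fun x => f (2 * pi * (t * x)))).
Proof.
move=> cf f1; apply: (@bounded_continuous_integrable _ 1) => //.
exact: continuous_wave.
Qed.

Lemma cintegrable_chi t : cintegrable mu (fun x => chi (t * x)).
Proof.
split; first exact: integrable_wave _ (@continuous_cos R) (@cos_max R).
exact: integrable_wave _ (@continuous_sin R) (@sin_max R).
Qed.

Definition fourier (t : R) : R[i] := cintegral mu (fun x => chi (t * x)).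

Lemma fourier0 : fourier 0 = 1.
Proof.
rewrite /fourier /cintegral; apply/eqP; rewrite eq_complex /=.
under eq_Rintegral do rewrite mul0r mulr0 cos0.
under [X in _ && (X == _)]eq_Rintegral do rewrite mul0r mulr0 sin0.
by rewrite !Rintegral_const !eqxx.
Qed.

Lemma fourierN t : fourier (- t) = conjc (fourier t).
Proof.
rewrite /fourier /cintegral; apply/eqP; rewrite eq_complex /=.
under eq_Rintegral do rewrite mulNr mulrN cosN.
under [X in _ && (X == _)]eq_Rintegral do rewrite mulNr mulrN sinN -mulN1r.
rewrite eqxx RintegralZl ?mulN1r ?eqxx//.
exact: integrable_wave _ (@continuous_sin R) (@sin_max R).
Qed.

(** Dominated convergence; applied to cosine and sine it is the continuity of
    the Fourier transform at 0, along a geometric sequence. *)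
Lemma Rintegral_wave_cvg (f : R -> R) (t : R) (b : nat) : (1 < b)%N ->
  continuous f -> (forall x, `|f x| <= 1) ->
  \int[mu]_x f (2 * pi * (t / b%:R ^+ n * x)) @[n --> \oo] --> f 0.
Proof.
move=> b1 cf f1.
have := @dominated_convergence _ _ _ mu setT measurableT
  (fun n x => (f (2 * pi * (t / b%:R ^+ n * x)))%:E) (fun=> (f 0)%:E) (cst 1%E).
case.
- move=> n; apply/measurable_EFinP; apply: continuous_measurable_fun.
  exact: continuous_wave.
- exact: measurable_cst.
- apply: aeW => x _; apply: cvg_EFin; first exact: nearW.
  suff lin : 2 * pi * (t / b%:R ^+ n * x) @[n --> \oo] --> 0.
    exact: (cvg_comp _ _ lin (cf 0)).
  rewrite -(mulr0 (2 * pi)); apply: cvgM; first exact: cvg_cst.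
  rewrite -(mul0r x); apply: cvgM; last exact: cvg_cst.
  rewrite -(mulr0 t); apply: cvgM; first exact: cvg_cst.
  under eq_fun do rewrite -exprVn.
  apply: cvg_expr; rewrite normrV ?unitfE ?pnatr_eq0; last by lia.
  by rewrite ger0_norm ?ler0n// invf_lt1 ?ltr0n ?(ltr_nat _ 1)//; lia.
- by apply: finite_measure_integrable_cst.
- by apply: aeW => x n _; rewrite /= lee_fin f1.
move=> Icst _; have -> : (\int[mu]_(x in setT) (f 0)%:E = (f 0)%:E)%E.
  by rewrite -[in RHS](Rintegral_const (f 0)) /Rintegral fineK ?integrable_fin_num.
exact: fine_cvg.
Qed.

Lemma nsq_fourier_cvg (t : R) (b : nat) : (1 < b)%N ->
  nsq (fourier (t / b%:R ^+ n)) @[n --> \oo] --> (1 : R).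
Proof.
move=> b1; under eq_fun do rewrite nsqE !expr2 /=.
have C := Rintegral_wave_cvg t b1 (@continuous_cos R) (@cos_max R).
have S := Rintegral_wave_cvg t b1 (@continuous_sin R) (@sin_max R).
have := cvgD (cvgM C C) (cvgM S S).
by rewrite cos0 sin0 mulr1 mulr0 addr0; exact.
Qed.

Lemma nsq_fourierB1_cvg (t : R) (b : nat) : (1 < b)%N ->
  nsq (fourier (t / b%:R ^+ n) - 1) @[n --> \oo] --> (0 : R).
Proof.
move=> b1; under eq_fun do rewrite nsqE !expr2 /=.
have C := cvgB (Rintegral_wave_cvg t b1 (@continuous_cos R) (@cos_max R))
  (cvg_cst (1 : R)).
have S := cvgB (Rintegral_wave_cvg t b1 (@continuous_sin R) (@sin_max R))
  (cvg_cst (0 : R)).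
have := cvgD (cvgM (C _ _) (C _ _)) (cvgM (S _ _) (S _ _)).
by rewrite cos0 sin0 !subrr mulr0 addr0; exact.
Qed.

Section SelfSimilar.
Context {q b : nat} (hq : (1 < q)%N).
Hypothesis hmu : self_similar q b mu.

(** The invariance equation says that mu is the average of its images under
    the maps of the system, as a sum of measures. *)
Lemma ge0_integral_self_similar (f : R -> R) : measurable_fun setT f ->
  (forall x, 0 <= f x) ->
  (\int[mu]_x (f x)%:E =
   \sum_(i < q) (q%:R^-1)%:E * \int[mu]_x (f (ifs_map b i x))%:E)%E.
Proof.
move=> mf f0.
have q0 : 0 <= q%:R^-1 :> R by rewrite invr_ge0.
pose k : {nonneg R} := NngNum q0.
pose nu (i : nat) : {measure set (measurableTypeR R) -> \bar R} :=
  mscale k (pushforward mu (@ifs_map R b i)).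
have mfE : measurable_fun setT (EFin \o f : measurableTypeR R -> \bar R).
  by apply/measurable_EFinP.
rewrite (@eq_measure_integral _ _ _ _ (msum (nu (@measurable_ifs_map R b)) q)); last first.
  by move=> A mA _; exact: hmu.
rewrite ge0_integral_measure_sum//; last by move=> x _; rewrite lee_fin.
apply: eq_bigr => i _; rewrite /nu ge0_integral_mscale//; last first.
  by move=> x _; rewrite lee_fin.
congr (_ * _)%E; rewrite ge0_integral_pushforward ?preimage_setT//.
- exact: measurable_ifs_map.
- by move=> x _; rewrite lee_fin.
Qed.

Lemma Rintegral_self_similar (f : R -> R) : continuous f ->
  (forall x, `|f x| <= 1) ->
  \int[mu]_x f x = q%:R^-1 * \sum_(i < q) \int[mu]_x f (ifs_map b i x).
Proof.
move=> cf f1.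
have cfi i : continuous (fun x => f (ifs_map b i x)).
  by move=> x; exact: (cvg_comp _ _ (@continuous_ifs_map R b i x) (cf _)).
have If : mu.-integrable setT (EFin \o f) by exact: bounded_continuous_integrable.
have Ifi i : mu.-integrable setT (EFin \o (fun x => f (ifs_map b i x))).
  exact: (@bounded_continuous_integrable _ 1).
have I1 : mu.-integrable setT (EFin \o (fun=> 1 : R)).
  by apply: finite_measure_integrable_cst.
(* adding 1 makes a function bounded by 1 in modulus nonnegative *)
have shift (g : R -> R) : mu.-integrable setT (EFin \o g) ->
    (\int[mu]_x (g x + 1)%:E = (\int[mu]_x g x + 1)%:E)%E.
  move=> Ig; rewrite -[X in (_ + X)%:E](_ : \int[mu]_x 1 = 1); last first.
    exact: Rintegral_const.
  rewrite -RintegralD// /Rintegral fineK// integrable_fin_num//.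
  exact: eq_integrable (integrableD measurableT Ig I1).
have m1 : measurable_fun setT (fun x => f x + 1).
  by apply: continuous_measurable_fun => x; apply: cvgD; [exact: cf|exact: cvg_cst].
have p1 x : 0 <= f x + 1.
  by have := f1 x; rewrite ler_norml -lerBlDr sub0r => /andP[].
have := ge0_integral_self_similar m1 p1; rewrite (shift f If).
rewrite (eq_bigr (fun i : 'I_q =>
  (q%:R^-1 * (\int[mu]_x f (ifs_map b i x) + 1))%:E)); last first.
  by move=> i _; rewrite (shift (fun x => f (ifs_map b i x)))// EFinM.
rewrite sumEFin => -[h]; apply: (@addIr _ 1); rewrite h.
rewrite -big_distrr /= big_split /= mulrDr sumr_const card_ord mulVf//.
by rewrite pnatr_eq0; lia.
Qed.

Lemma fourier_self_similar t : fourier t =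
  q%:R^-1 * (\sum_(k < q) chi (k%:R * (t / b%:R))) * fourier (t / b%:R).
Proof.
have wave f k x : f (2 * pi * (t * ifs_map b k x)) =
    f (2 * pi * (k%:R * (t / b%:R)) + 2 * pi * (t / b%:R * x)) :> R.
  by congr f; rewrite /ifs_map; ring.
rewrite -mulrA big_distrl /=.
have -> : (q%:R^-1 : R[i]) = (q%:R^-1 : R)%:C%C by rewrite fmorphV rmorph_nat.
apply/eqP; rewrite eq_complex ReM ImM Re_sum Im_sum /= !mul0r subr0 addr0.
rewrite (Rintegral_self_similar (f := fun x => cos (2 * pi * (t * x)))); last 2 first.
- exact/continuous_wave/continuous_cos.
- by move=> x; exact: cos_max.
rewrite (Rintegral_self_similar (f := fun x => sin (2 * pi * (t * x)))); last 2 first.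
- exact/continuous_wave/continuous_sin.
- by move=> x; exact: sin_max.
have Ic := integrable_wave (t / b%:R) (@continuous_cos R) (@cos_max R).
have Is := integrable_wave (t / b%:R) (@continuous_sin R) (@sin_max R).
have Z s h : mu.-integrable setT (EFin \o h) ->
    mu.-integrable setT (EFin \o (fun x => s * h x)).
  by move=> hi; apply: eq_integrable (integrableZl measurableT s hi).
apply/andP; split; apply/eqP; congr (_ * _); apply: eq_bigr => k _; rewrite ?ReM ?ImM /=.
- under eq_Rintegral do rewrite wave cosD.
  by rewrite RintegralB ?RintegralZl//; exact: Z.
- under eq_Rintegral do rewrite wave sinD addrC.
  by rewrite RintegralD ?RintegralZl//; exact: Z.
Qed.

Lemma nsq_fourier_self_similar t :
  nsq (fourier t) = mask q (t / b%:R) * nsq (fourier (t / b%:R)).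
Proof. by rewrite fourier_self_similar nsqM. Qed.

End SelfSimilar.
End Fourier.

(** * Closed spans of exponentials *)
Section Hilbert.
Context {R : realType} (mu : probability (measurableTypeR R) R).
Local Notation X := (measurableTypeR R).
Implicit Types (f g h : X -> R[i]) (s : seq (R[i] * R)) (L : set R).

Local Arguments conjc : simpl never.

Lemma nsqD_le (z1 z2 : R[i]) : nsq (z1 + z2) <= 2 * nsq z1 + 2 * nsq z2.
Proof.
rewrite !nsqE; case: z1 z2 => [a b] [c e] /=.
have := sqr_ge0 (a - c); have := sqr_ge0 (b - e); nra.
Qed.

Definition cmeasurable f : Prop :=
  measurable_fun setT (fun x => complex.Re (f x)) /\
  measurable_fun setT (fun x => complex.Im (f x)).

Lemma cmeasurableD f g : cmeasurable f -> cmeasurable g ->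
  cmeasurable (fun x => f x + g x).
Proof.
move=> [fr fi] [gr gi]; split.
  by under eq_fun do rewrite ReD; exact: measurable_funD.
by under eq_fun do rewrite ImD; exact: measurable_funD.
Qed.

Lemma cmeasurableZ (c : R[i]) f : cmeasurable f -> cmeasurable (fun x => c * f x).
Proof.
move=> [fr fi]; split.
  under eq_fun do rewrite ReM.
  by apply: measurable_funB; apply: measurable_funM => //; exact: measurable_cst.
under eq_fun do rewrite ImM.
by apply: measurable_funD; apply: measurable_funM => //; exact: measurable_cst.
Qed.

Lemma cmeasurable_chi (t : R) : cmeasurable (fun x => chi (t * x)).
Proof.
split; apply: continuous_measurable_fun.
  exact: continuous_wave (@continuous_cos R).
exact: continuous_wave (@continuous_sin R).
Qed.

(** A trigonometric polynomial, encoded as a list of pairs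
    (coefficient, frequency). *)
Definition trigpoly s : X -> R[i] := fun x => \sum_(p <- s) p.1 * chi (p.2 * x).

Lemma cmeasurable_trigpoly s : cmeasurable (trigpoly s).
Proof.
elim: s => [|p s IH]; rewrite /trigpoly.
  by under [X in cmeasurable X]eq_fun do rewrite big_nil; split; exact: measurable_cst.
under [X in cmeasurable X]eq_fun do rewrite big_cons.
by apply: cmeasurableD IH; apply: cmeasurableZ; exact: cmeasurable_chi.
Qed.

Lemma cmeasurableB f g : cmeasurable f -> cmeasurable g ->
  cmeasurable (fun x => f x - g x).
Proof.
move=> mf mg; under [X in cmeasurable X]eq_fun do rewrite -mulN1r.
by apply: cmeasurableD => //; exact: cmeasurableZ.
Qed.

Lemma measurable_nsq f : cmeasurable f ->
  measurable_fun setT (fun x => nsq (f x)).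
Proof.
move=> [fr fi]; under eq_fun do rewrite nsqE !expr2.
by apply: measurable_funD; apply: measurable_funM.
Qed.

Definition dist2 f g : \bar R := (\int[mu]_x (nsq (f x - g x))%:E)%E.

Lemma dist2_ge0 f g : (0 <= dist2 f g)%E.
Proof. by apply: integral_ge0 => x _; rewrite lee_fin nsq_ge0. Qed.

(** The form in which the inequality |z + z'|^2 <= 2 |z|^2 + 2 |z'|^2 is
    integrated: it replaces the triangle inequality of the L^2-norm. *)
Lemma dist2_lt (f f1 f2 g g1 g2 : X -> R[i]) (a e e1 e2 : R) :
  cmeasurable f -> cmeasurable g -> cmeasurable f1 -> cmeasurable g1 ->
  cmeasurable f2 -> cmeasurable g2 -> 0 <= a ->
  (forall x, nsq (f x - g x) <= a * nsq (f1 x - g1 x) + 2 * nsq (f2 x - g2 x)) ->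
  (dist2 f1 g1 < e1%:E)%E -> (dist2 f2 g2 < e2%:E)%E -> a * e1 + 2 * e2 <= e ->
  (dist2 f g < e%:E)%E.
Proof.
move=> mf mg mf1 mg1 mf2 mg2 a0 hle d1 d2 ae.
have M u v : cmeasurable u -> cmeasurable v ->
    measurable_fun setT (fun x => (nsq (u x - v x))%:E).
  move=> mu' mv; apply/measurable_EFinP.
  by apply: (@measurable_nsq (fun x => u x - v x)); exact: cmeasurableB.
have le1 : (dist2 f g <= a%:E * dist2 f1 g1 + 2%:E * dist2 f2 g2)%E.
  rewrite /dist2 -!ge0_integralZl_EFin//; first last.
  - exact: M.
  - by move=> x _; rewrite lee_fin nsq_ge0.
  - exact: M.
  - by move=> x _; rewrite lee_fin nsq_ge0.
  have Mz (k : R) u v : cmeasurable u -> cmeasurable v ->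
      measurable_fun setT (fun x => (k%:E * (nsq (u x - v x))%:E)%E).
    by move=> mu' mv; apply: measurable_funeM; exact: M.
  have z0 (k : R) (z : R[i]) : 0 <= k -> (0 <= k%:E * (nsq z)%:E)%E.
    by move=> k0; apply: mule_ge0; rewrite lee_fin ?nsq_ge0.
  rewrite -ge0_integralD//; try exact: Mz; try by move=> x _; exact: z0.
  apply: ge0_le_integral => //.
  - by move=> x _; rewrite lee_fin nsq_ge0.
  - exact: M.
  - by apply: emeasurable_funD; exact: Mz.
  - by move=> x _; rewrite -!EFinM -EFinD lee_fin.
apply: le_lt_trans le1 _; move: d1 d2 (dist2_ge0 f1 g1) (dist2_ge0 f2 g2).
case: (dist2 f1 g1) => [D1| |]//; case: (dist2 f2 g2) => [D2| |]//.
rewrite -!EFinM -EFinD !lte_fin !lee_fin => d1 d2 _ _; nra.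
Qed.

(** Membership in the closed linear span of the exponentials with frequencies
    in L. *)
Definition approx L f : Prop := forall eps : R, 0 < eps ->
  exists s, (forall p, p \in s -> L p.2) /\ (dist2 f (trigpoly s) < eps%:E)%E.

Lemma approx_closed L f : cmeasurable f ->
  (forall eps : R, 0 < eps ->
     exists g, [/\ cmeasurable g, approx L g & (dist2 f g < eps%:E)%E]) ->
  approx L f.
Proof.
move=> mf hf eps e0; have e4 : 0 < eps / 4 by rewrite divr_gt0.
have [g [mg ag fg]] := hf _ e4; have [s [sL gs]] := ag _ e4.
exists s; split=> //.
apply: (dist2_lt _ _ _ _ _ _ _ _ fg gs (a := 2)) => //.
- exact: cmeasurable_trigpoly.
- exact: cmeasurable_trigpoly.
- move=> x; have -> : f x - trigpoly s x = (f x - g x) + (g x - trigpoly s x) by ring.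
  exact: nsqD_le.
- by lra.
Qed.

Lemma approx_addZ L (c : R[i]) f g : cmeasurable f -> cmeasurable g ->
  approx L f -> approx L g -> approx L (fun x => c * f x + g x).
Proof.
move=> mf mg af ag eps e0.
have c0 := nsq_ge0 c; pose a := 2 * nsq c.
have a0 : 0 <= a by rewrite /a; lra.
have e1 : 0 < eps / 2 / (a + 1) by rewrite !divr_gt0//; lra.
have e2 : 0 < eps / 4 by rewrite divr_gt0.
have [s1 [s1L d1]] := af _ e1; have [s2 [s2L d2]] := ag _ e2.
exists ([seq (c * p.1, p.2) | p <- s1] ++ s2); split.
  by move=> p; rewrite mem_cat => /orP[/mapP[p' /s1L ? ->]//|]; exact: s2L.
apply: (dist2_lt _ _ _ _ _ _ a0 _ d1 d2) => //; try exact: cmeasurable_trigpoly.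
- by apply: cmeasurableD => //; exact: cmeasurableZ.
- move=> x; have -> : trigpoly ([seq (c * p.1, p.2) | p <- s1] ++ s2) x =
      c * trigpoly s1 x + trigpoly s2 x.
    rewrite /trigpoly big_cat big_map big_distrr /=; congr (_ + _).
    by apply: eq_bigr => p _; rewrite mulrA.
  rewrite /a -mulrA -nsqM.
  have -> : c * f x + g x - (c * trigpoly s1 x + trigpoly s2 x) =
    c * (f x - trigpoly s1 x) + (g x - trigpoly s2 x) by ring.
  exact: nsqD_le.
- have : a * (eps / 2 / (a + 1)) <= eps / 2.
    rewrite mulrA ler_pdivrMr; last by lra.
    by nra.
  by lra.
Qed.

Lemma approx_trigpoly L s : (forall p, p \in s -> approx L (fun x => chi (p.2 * x))) ->
  approx L (trigpoly s).
Proof.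
elim: s => [|p s IH] hs.
  move=> eps e0; exists [::]; split=> //; rewrite /dist2.
  under eq_integral do rewrite subrr nsq0.
  by rewrite integral0 lte_fin.
have -> : trigpoly (p :: s) = fun x => p.1 * chi (p.2 * x) + trigpoly s x.
  by apply/funext => x; rewrite /trigpoly big_cons.
apply: approx_addZ.
- exact: cmeasurable_chi.
- exact: cmeasurable_trigpoly.
- by apply: hs; rewrite mem_head.
- by apply: IH => p' p's; apply: hs; rewrite inE p's orbT.
Qed.

Lemma approx_trans L L' f : cmeasurable f -> approx L f ->
  (forall l, L l -> approx L' (fun x => chi (l * x))) -> approx L' f.
Proof.
move=> mf af hL; apply: approx_closed => // eps /af[s [sL fs]].
exists (trigpoly s); split=> //; first exact: cmeasurable_trigpoly.
by apply: approx_trigpoly => p /sL; exact: hL.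
Qed.

Lemma dist2_trigpoly0 s : dist2 (trigpoly s) (fun=> 0) = (complex.Re
  (\sum_(p <- s) \sum_(p' <- s) p.1 * conjc p'.1 * fourier mu (p.2 - p'.2)))%:E.
Proof.
have E x : trigpoly s x * conjc (trigpoly s x) = \sum_(p <- s) \sum_(p' <- s)
    p.1 * conjc p'.1 * chi ((p.2 - p'.2) * x).
  rewrite /trigpoly rmorph_sum big_distrlr /=; apply: eq_bigr => p _.
  apply: eq_bigr => p' _; rewrite rmorphM mulrBl chiD chiN /=.
  by rewrite mulrACA.
have I (p p' : R[i] * R) : cintegrable mu (fun x => p.1 * conjc p'.1 * chi ((p.2 - p'.2) * x)).
  by apply: cintegrableZ; exact: cintegrable_chi.
have IE : (fun x => trigpoly s x * conjc (trigpoly s x)) = fun x => \sum_(p <- s) \sum_(p' <- s)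
    p.1 * conjc p'.1 * chi ((p.2 - p'.2) * x) by apply/funext.
rewrite /dist2; under eq_integral do rewrite subr0.
rewrite integral_nsq IE.
  rewrite cintegral_sum; last by move=> p; exact: cintegrable_sum.
  congr (complex.Re _)%:E; apply: eq_bigr => p _.
  rewrite cintegral_sum//; apply: eq_bigr => p' _.
  by rewrite cintegralZ//; exact: cintegrable_chi.
by apply: cintegrable_sum => p; exact: cintegrable_sum.
Qed.

(** Pythagoras: the distance to a combination of orthonormal exponentials
    splits into the distance to the span, given by the Fourier coefficients
    phi(eta - l), and the distance inside the span between the projection and
    the combination. *)
Lemma dist2_orthogonal (eta : R) (ls : seq R) (e : R -> R[i]) : uniq ls ->
  {in ls &, forall l l', l != l' -> nsq (fourier mu (l - l')) = 0} ->
  dist2 (fun x => chi (eta * x)) (trigpoly [seq (e l, l) | l <- ls]) =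
  (1 - \sum_(l <- ls) nsq (fourier mu (eta - l)) +
   \sum_(l <- ls) nsq (fourier mu (eta - l) - e l))%:E.
Proof.
move=> uls orth.
(* regard the difference as a single trigonometric polynomial *)
transitivity (dist2 (trigpoly ((1, eta) :: [seq (- e l, l) | l <- ls])) (fun=> 0)).
  apply: eq_integral => x _; congr (nsq _)%:E.
  rewrite subr0 /trigpoly big_cons !big_map /= mul1r -sumrN; congr (_ + _).
  by apply: eq_bigr => l _; rewrite mulNr.
rewrite dist2_trigpoly0; set S := \sum_(p <- _) _; set y : R := _ + _.
suff -> : S = y%:C%C by [].
rewrite {}/S {}/y.
rewrite big_cons !big_map !big_cons /= !big_map /= subrr fourier0 conjc1 !mulr1.
rewrite [X in _ + X = _](eq_big_seq (fun l => - e l * conjc (fourier mu (eta - l)) + e l * conjc (e l))).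
  rewrite rmorphD rmorphB !rmorph_sum rmorph1 /= big_split /= addrA.
  rewrite -!addrA; congr (_ + _); rewrite !addrA -!big_split /= -sumrN -big_split /=.
  apply: eq_bigr => l _; rewrite !nsqC rmorphB /= mul1r rmorphN /=.
  ring.
move=> l lls; rewrite big_cons big_map conjc1 mulr1 -fourierN opprB; congr (_ + _).
rewrite (bigD1_seq l)//= big1_seq ?addr0.
  by rewrite subrr fourier0 rmorphN mulrNN mulr1.
move=> l' /andP[l'l l'ls]; rewrite (nsq_eq0 (orth _ _ lls l'ls _)) ?mulr0//.
by rewrite eq_sym.
Qed.

Lemma expi2piE (l : R) (x : X) : expi2pi l x = chi (l * x).
Proof. by rewrite /expi2pi /chi !mulrA. Qed.

Lemma approxP L f : approx L f <->
  forall eps : R, 0 < eps ->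
    exists (n : nat) (j : 'I_n -> R) (c : 'I_n -> R[i]), (forall i, L (j i)) /\
    (\int[mu]_x ((ComplexField.Normc.normc
        (f x - \sum_(i < n) c i * expi2pi (j i) x) ^+ 2)%:E) < (eps ^+ 2)%:E)%E.
Proof.
split=> [af eps e0|hf eps e0].
  have [s [sL fs]] := af (eps ^+ 2) (exprn_gt0 _ e0).
  exists (size s), (fun i => (nth 0 s i).2), (fun i => (nth 0 s i).1); split.
    by move=> i; apply: sL; exact: mem_nth.
  move: fs; congr (_ < _)%E; apply: eq_integral => x _.
  congr (nsq (_ - _))%:E; rewrite /trigpoly (big_nth 0) big_mkord.
  by apply: eq_bigr => i _; rewrite expi2piE.
have [] := hf (Num.sqrt eps); first by rewrite sqrtr_gt0.
move=> n [j [c [jL]]]; rewrite sqr_sqrtr ?ltW// => fs.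
exists [seq (c i, j i) | i <- enum 'I_n]; split.
  by move=> p /mapP[i _ ->]; exact: jL.
move: fs; congr (_ < _)%E; apply: eq_integral => x _.
congr (nsq (_ - _))%:E; rewrite /trigpoly big_map big_enum /=.
by apply: eq_bigr => i _; rewrite expi2piE.
Qed.

End Hilbert.

(** * Words and mappings *)
Section Words.
Context {q : nat} (hq : (1 < q)%N).
Local Notation o := (letter0 hq).

Lemma zerosD m n : zeros hq (m + n) = zeros hq m ++ zeros hq n.
Proof. by rewrite /zeros nseqD. Qed.

Lemma zerosS n : zeros hq n.+1 = zeros hq n ++ [:: o].
Proof. by rewrite -addn1 zerosD. Qed.

Lemma regular_onP (t : word q -> int) s : regular_on t s <->
  exists K, forall k, (K <= k)%N -> t (iprefix s k) = 0.
Proof. by split=> [[K _ hK]|[K hK]]; exists K => // k; exact: hK. Qed.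

Lemma iprefix_pad0 (w : word q) k : (size w <= k)%N ->
  iprefix (pad0 hq w) k = w ++ zeros hq (k - size w).
Proof.
move=> wk; apply: (@eq_from_nth _ o).
  by rewrite size_mkseq size_cat size_nseq subnKC.
move=> i; rewrite size_mkseq => ik; rewrite nth_mkseq// nth_cat /pad0.
by case: ltnP => // wi; rewrite nth_nseq if_same nth_default.
Qed.

Lemma pad0_zeros (w : word q) k : pad0 hq (w ++ zeros hq k) = pad0 hq w.
Proof.
apply/funext => i; rewrite /pad0 nth_cat; case: ltnP => // wi.
by rewrite nth_nseq if_same nth_default.
Qed.

Lemma Gamma_pad0 (w : word q) : Gamma hq (pad0 hq w).
Proof.
elim/last_ind: w => [|w a IH]; first by exists [::]; split=> //; left.
have [->|/eqP ao] := eqVneq a o.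
  by rewrite -cats1 (pad0_zeros w 1).
by exists (rcons w a); split=> //; right; rewrite /last_nonzero last_rcons.
Qed.

End Words.

Section Mappings.
Context {q r : nat} (hq : (1 < q)%N) (hr : (1 < r)%N).
Local Notation b := (q * r)%N.
Local Notation o := (letter0 hq).
Implicit Types (t : word q -> int) (w u v : word q) (a : 'I_q).

Definition subtree t w : word q -> int := fun v => t (w ++ v).

Lemma subtree_cat t u v : subtree (subtree t u) v = subtree t (u ++ v).
Proof. by apply/funext => w; rewrite /subtree catA. Qed.

(** What remains of maximality in a subtree, where the condition on the words
    0^n may fail. *)
Definition admissible (base : nat) t : Prop :=
  forall w a, digits_of base a (t (rcons w a)).

Lemma admissible_subtree t w : admissible b t -> admissible b (subtree t w).
Proof. by move=> ht v a; rewrite /subtree -rcons_cat; exact: ht. Qed.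

Lemma maximal_admissible (t : word q -> int) :
  maximal_mapping hq b t -> admissible b t.
Proof. by case. Qed.

Section Regularized.
Variables (tau : word q -> int) (N : nat) (I : 'I_N -> word q).
Local Notation tauR := (regularized hq I tau).

Lemma regularized_eq0 i k : (1 <= k)%N -> tauR (I i ++ zeros hq k) = 0.
Proof. by move=> k1; rewrite /regularized ifT//; apply/asboolP; exists i, k. Qed.

Lemma regularized_id w : (forall i k, (1 <= k)%N -> w <> I i ++ zeros hq k) ->
  tauR w = tau w.
Proof. by move=> h; rewrite /regularized ifF//; apply/asboolPn => -[i [k [k1]]]; exact: h. Qed.

Lemma regularizedP w : tauR w = tau w \/
  tauR w = 0 /\ exists i k, (1 <= k)%N /\ w = I i ++ zeros hq k.
Proof.
by rewrite /regularized; case: ifP => [/asboolP h|_]; [right|left].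
Qed.

Lemma digits0 : digits b 0.
Proof. by rewrite /digits /=; nia. Qed.

Lemma admissible_regularized : admissible b tau -> admissible b tauR.
Proof.
move=> ha w a; case: (regularizedP (rcons w a)) => [->//|[-> [i [[|k] [// _ e]]]]].
split; last exact: digits0.
have := congr1 (last o) e; rewrite last_rcons zerosS catA cats1 last_rcons => ->.
by exists 0; rewrite /= mulr0.
Qed.

Hypothesis htau : maximal_mapping hq b tau.
Hypothesis hirr : [set s | Gamma hq s /\ ~ regular_on tau s] =
                  [set pad0 hq (I i) | i in [set: 'I_N]].

Lemma regular_regularized w : regular_on tauR (pad0 hq w).
Proof.
have [/regular_onP[K hK]|nreg] := pselect (regular_on tau (pad0 hq w)).
  apply/regular_onP; exists K => k Kk.
  by case: (regularizedP (iprefix (pad0 hq w) k)) => [->|[]//]; exact: hK.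
have : [set s | Gamma hq s /\ ~ regular_on tau s] (pad0 hq w).
  by split=> //; exact: Gamma_pad0.
rewrite hirr => -[i _ <-]; apply/regular_onP; exists (size (I i)).+1 => k ik.
by rewrite iprefix_pad0 ?(ltnW ik)// regularized_eq0// subn_gt0.
Qed.

Lemma maximal_regularized : maximal_mapping hq b tauR.
Proof.
case: (htau) => h1 [h2 h2'] h3 h4; split.
- by move=> w; case: (regularizedP w) => [->//|[-> _]]; exact: digits0.
- split; first by case: (regularizedP [::]) => [->|[]].
  by move=> n n1; case: (regularizedP (zeros hq n)) => [->|[]//]; exact: h2'.
- exact: admissible_regularized.
- by move=> w; exists [::]; exact: regular_regularized.
Qed.

End Regularized.
End Mappings.

(** * The random walk attached to a mapping *)
Section Tree.
Context {R : realType} {q r : nat} (hq : (1 < q)%N) (hr : (1 < r)%N).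
Implicit Types (t : word q -> int) (w u v : word q) (a : 'I_q) (x : R).

Local Notation b := (q * r)%N.
Local Notation o := (letter0 hq).

(** The point reached from x by the letter a: if the digit expansion of
    lambda starts with t(a) and continues with that of lambda', then
    (x + r lambda)/b and push t x a + r lambda' coincide. *)
Definition push t x a : R := (x + r%:R * (t [:: a])%:~R) / b%:R.

Fixpoint pushes t x w : R :=
  if w is a :: v then pushes (subtree t [:: a]) (push t x a) v else x.

(** The probability that the walk started at x reads the word w. *)
Fixpoint weight t x w : R :=
  if w is a :: v then
    mask q (push t x a) * weight (subtree t [:: a]) (push t x a) v
  else 1.

Lemma pushes_cat t x u v :
  pushes t x (u ++ v) = pushes (subtree t u) (pushes t x u) v.
Proof. by elim: u t x => //= a u IH t x; rewrite IH. Qed.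

Lemma weight_cat t x u v : weight t x (u ++ v) =
  weight t x u * weight (subtree t u) (pushes t x u) v.
Proof. by elim: u t x => [|a u IH] t x /=; rewrite ?mul1r// IH mulrA. Qed.

Lemma weight_rcons t x w a : weight t x (w ++ [:: a]) =
  weight t x w * mask q (push (subtree t w) (pushes t x w) a).
Proof. by rewrite weight_cat /= mulr1. Qed.

Let b_neq0 : b%:R != 0 :> R.
Proof. by rewrite pnatr_eq0; lia. Qed.

Let q_neq0 : q%:R != 0 :> R.
Proof. by rewrite pnatr_eq0; lia. Qed.

Let r_neq0 : r%:R != 0 :> R.
Proof. by rewrite pnatr_eq0; lia. Qed.

(** The child points are translates of x/b by t(a)/q, and the t(a) form a
    complete residue system modulo q. *)
Lemma mask_push_sum t x : admissible b t -> \sum_a mask q (push t x a) = 1.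
Proof.
move=> ht; rewrite -[RHS](mask_sum_digits hq (x / b%:R) (t := fun a => t [:: a])).
  apply: eq_bigr => a _; congr mask; rewrite /push natrM; field.
  by rewrite q_neq0 r_neq0.
by move=> a; have [[m hm] _] := ht [::] a; exists m.
Qed.

Lemma weight_ge0 t x w : 0 <= weight t x w.
Proof.
by elim: w t x => //= a w IH t x; rewrite mulr_ge0 ?mask_ge0.
Qed.

Lemma weight_le1 t x w : weight t x w <= 1.
Proof.
elim: w t x => //= a w IH t x.
by rewrite mulr_ile1 ?mask_ge0 ?weight_ge0 ?mask_le1.
Qed.

Lemma weight_zeros_homo t x :
  {homo (fun n => weight t x (zeros hq n)) : m n / (m <= n)%N >-> n <= m}.
Proof.
move=> m n /subnKC <-; rewrite zerosD weight_cat.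
by rewrite ler_piMr ?weight_ge0 ?weight_le1.
Qed.

(** The probability of the infinite branch 0^oo. *)
Definition spine t x : R := limn (fun n => weight t x (zeros hq n)).

Lemma is_cvg_spine t x : cvgn (fun n => weight t x (zeros hq n)).
Proof.
apply: nonincreasing_is_cvgn; first exact: weight_zeros_homo.
by exists 0 => _ [n _ <-]; exact: weight_ge0.
Qed.

Lemma spine_le t x n : spine t x <= weight t x (zeros hq n).
Proof.
exact: (nonincreasing_cvgn_ge (weight_zeros_homo t x) (@is_cvg_spine t x)).
Qed.

Lemma spine_ge0 t x : 0 <= spine t x.
Proof.
apply: limr_ge; first exact: is_cvg_spine.
by apply: nearW => n; exact: weight_ge0.
Qed.

Lemma spine_le1 t x : spine t x <= 1.
Proof. exact: (spine_le t x 0%N). Qed.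

Lemma spine_zeros t x n : spine t x = weight t x (zeros hq n) *
  spine (subtree t (zeros hq n)) (pushes t x (zeros hq n)).
Proof.
have c1 : weight t x (zeros hq (k + n)) @[k --> \oo] --> spine t x.
  have := @cvg_shiftn n R (fun k => weight t x (zeros hq k)).
  by move=> ->; exact: is_cvg_spine.
rewrite -(cvg_lim _ c1)//; apply: cvg_lim => //.
under eq_fun do rewrite addnC zerosD weight_cat.
by apply: cvgM; [exact: cvg_cst | exact: is_cvg_spine].
Qed.

(** The probability that all letters after the n-th one are zero. *)
Fixpoint mass n t x : R :=
  if n is m.+1 then
    \sum_a mask q (push t x a) * mass m (subtree t [:: a]) (push t x a)
  else spine t x.

Lemma mass_leS n t x : mass n t x <= mass n.+1 t x.
Proof.
elim: n t x => [|n IH] t x.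
  rewrite [leLHS]/= (spine_zeros t x 1) /= mulr1 (bigD1 o)//= lerDl.
  by apply: sumr_ge0 => a _; rewrite mulr_ge0 ?mask_ge0 ?spine_ge0.
rewrite [leLHS]/= [leRHS]/=.
by apply: ler_sum => a _; rewrite ler_wpM2l ?mask_ge0// IH.
Qed.

Lemma mass_le1 n t x : admissible b t -> mass n t x <= 1.
Proof.
elim: n t x => [|n IH] t x ht /=; first exact: spine_le1.
rewrite -(mask_push_sum x ht); apply: ler_sum => a _.
by rewrite ler_piMr ?mask_ge0 ?IH//; exact: admissible_subtree.
Qed.

(** The probability of the set of branches that end in zeros. *)
Definition total t x : R := limn (fun n => mass n t x).

Lemma mass_homo t x : {homo (fun n => mass n t x) : m n / (m <= n)%N >-> m <= n}.
Proof.
move=> m n /subnKC <-; elim: (n - m)%N => [|k IH]; first by rewrite addn0.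
by rewrite addnS; apply: le_trans IH (mass_leS _ _ _).
Qed.

Lemma is_cvg_total t x : admissible b t -> cvgn (fun n => mass n t x).
Proof.
move=> ht; apply: nondecreasing_is_cvgn; first exact: mass_homo.
by exists 1 => _ [n _ <-]; exact: mass_le1.
Qed.

Lemma mass_le_total n t x : admissible b t -> mass n t x <= total t x.
Proof.
move=> ht.
exact: (nondecreasing_cvgn_le (mass_homo t x) (is_cvg_total (x := x) ht)).
Qed.

Lemma total_le1 t x : admissible b t -> total t x <= 1.
Proof.
move=> ht; apply: limr_le; first exact: is_cvg_total.
by apply: nearW => n; exact: mass_le1.
Qed.

Lemma total_rec t x : admissible b t -> total t x =
  \sum_a mask q (push t x a) * total (subtree t [:: a]) (push t x a).
Proof.
move=> ht.
have c1 : mass (k + 1) t x @[k --> \oo] --> total t x.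
  have := @cvg_shiftn 1 R (fun k => mass k t x).
  by move=> ->; exact: is_cvg_total.
rewrite -(cvg_lim _ c1)//; apply: cvg_lim => //.
under eq_fun do rewrite addn1 /=.
apply: (cvg_big (@add_continuous R)) => a _; apply: cvgM; first exact: cvg_cst.
by apply: is_cvg_total; exact: admissible_subtree.
Qed.

Lemma irrational_push t x a : irrational x -> irrational (push t x a).
Proof.
move=> ix [s _ sx]; apply: ix; exists (s * b%:R - r%:R * (t [:: a])%:~R) => //.
rewrite rmorphB !rmorphM /= sx !ratr_nat ratr_int -natrM /push divfK//.
by rewrite addrK.
Qed.

Lemma mask_irrational_gt0 x : irrational x -> 0 < mask q x.
Proof.
move=> ix; rewrite lt_def mask_ge0 andbT; apply/eqP => /(mask_eq0 hq)[m qx].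
apply: ix; exists (m%:~R / q%:R) => //.
by rewrite fmorph_div /= ratr_int ratr_nat -qx mulrC mulrA mulVf// mul1r.
Qed.

(** The restriction to irrational points ensures that every node is reached
    with positive probability. *)
Definition full t : Prop := forall x, irrational x -> total t x = 1.

(** An average of numbers at most 1 with positive weights equals 1 only if
    they all do; every irrational point is the a-th child of an irrational
    point. *)
Lemma full_child t a : admissible b t -> full t -> full (subtree t [:: a]).
Proof.
move=> ht ft y iy.
pose x : R := y * b%:R - r%:R * (t [:: a])%:~R.
have pxy : push t x a = y by rewrite /push /x subrK mulfK.
have ix : irrational x.
  move=> [s _ sx]; apply: iy.
  exists ((s + r%:R * (t [:: a])%:~R) / b%:R) => //.
  rewrite fmorph_div rmorphD rmorphM /= sx !ratr_nat ratr_int.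
  by rewrite -[RHS]pxy.
have : \sum_a' mask q (push t x a') *
    (1 - total (subtree t [:: a']) (push t x a')) = 0.
  under eq_bigr do rewrite mulrBr mulr1.
  by rewrite sumrB mask_push_sum// -total_rec// ft// subrr.
move/psumr_eq0P => /(_ _ a isT) => /(_ _)/eqP; rewrite pxy mulf_eq0.
rewrite gt_eqF ?mask_irrational_gt0//= subr_eq0 => h.
apply/esym/eqP/h => a' _; rewrite mulr_ge0 ?mask_ge0// subr_ge0.
by apply: total_le1; exact: admissible_subtree.
Qed.

Lemma full_subtree t w : admissible b t -> full t -> full (subtree t w).
Proof.
elim: w t => [//|a w IH] t ht ft.
rewrite -(subtree_cat t [:: a]); apply: IH; first exact: admissible_subtree.
exact: full_child.
Qed.

Lemma full_children t : admissible b t ->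
  (forall a, full (subtree t [:: a])) -> full t.
Proof.
move=> ht hf x ix; rewrite total_rec// -(mask_push_sum x ht).
by apply: eq_bigr => a _; rewrite hf ?mulr1//; exact: irrational_push.
Qed.

Lemma full_level n t : admissible b t ->
  (forall w, size w = n -> full (subtree t w)) -> full t.
Proof.
elim: n t => [|n IH] t ht hf; first exact: (hf [::]).
apply: full_children => // a; apply: IH; first exact: admissible_subtree.
by move=> w sw; rewrite subtree_cat; apply: hf; rewrite /= sw.
Qed.

(** With full subtrees off the spine, the walk fails to end in zeros only if
    it stays on the spine for n steps and fails afterwards.  This has
    probability at most that of staying n steps minus that of the spine, which
    tends to 0 whether or not the spine has positive probability. *)
Lemma full_off_spine t : admissible b t ->
  (forall n a, a <> o -> full (subtree t (rcons (zeros hq n) a))) -> full t.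
Proof.
move=> ht hf x ix.
have key n : 1 - total t x = weight t x (zeros hq n) *
    (1 - total (subtree t (zeros hq n)) (pushes t x (zeros hq n))).
  elim: n t ht hf x ix => [|n IH] t ht hf x ix; first by rewrite /= mul1r.
  have hs : admissible b (subtree t [:: o]) by exact: admissible_subtree.
  have hfs k a : a <> o ->
      full (subtree (subtree t [:: o]) (rcons (zeros hq k) a)).
    by move=> ao; rewrite subtree_cat; exact: (hf k.+1).
  have ips : irrational (push t x o) by exact: irrational_push.
  have := IH _ hs hfs _ ips.
  rewrite /= -mulrA subtree_cat => <-.
  rewrite mulrBr mulr1 total_rec// (bigD1 o)//=.
  rewrite [X in _ - (_ + X)](eq_bigr (fun a => mask q (push t x a))).
    by rewrite -{1}(mask_push_sum x ht) (bigD1 o)//=; ring.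
  move=> a /eqP ao; rewrite (hf 0%N a ao) ?mulr1//.
  exact: irrational_push.
apply/eqP; rewrite eq_le total_le1//= -subr_le0 -(lerD2l (spine t x)) addr0.
apply: limr_ge; first exact: is_cvg_spine.
apply: nearW => n; rewrite (key n) (spine_zeros t x n) -mulrDr.
rewrite ler_piMr ?weight_ge0// addrCA gerDl subr_le0.
by apply: (mass_le_total 0); exact: admissible_subtree.
Qed.

(** * Irregular spines have probability zero *)
Section Irregular.
Variable t : word q -> int.
Hypothesis ht : admissible b t.

(** The letter 0 forces a multiple of q; between -1 and b - 2 = q r - 2 there
    are only those from 0 to q (r - 1). *)
Lemma zeros_digit n : exists s : nat, (s < r)%N /\ t (zeros hq n.+1) = q%:Z * s%:Z.
Proof.
rewrite zerosS cats1; have [[m /= hm]] := ht (zeros hq n) o.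
rewrite hm /digits /= => /andP[m1 m2].
have m0 : 0 <= m.
  rewrite leNgt; apply/negP => mn; have : q%:Z * m <= q%:Z * (-1).
    by rewrite ler_wpM2l//; lia.
  by lia.
have mr : m < r%:Z.
  rewrite ltNge; apply/negP => mr; have : q%:Z * r%:Z <= q%:Z * m.
    by rewrite ler_wpM2l.
  by lia.
by exists `|m|%N; split; [lia|rewrite add0r gez0_abs].
Qed.

Let b_gt0 : 0 < b%:R :> R.
Proof. by rewrite ltr0n; lia. Qed.

Lemma pushes_zerosS (x : R) n s : t (zeros hq n.+1) = q%:Z * s%:Z ->
  pushes t x (zeros hq n.+1) =
  pushes t x (zeros hq n) / b%:R + s%:R.
Proof.
move=> e; rewrite zerosS pushes_cat /= /push /subtree -zerosS e.
rewrite intrM natrM; field.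
by rewrite !pnatr_eq0; lia.
Qed.

(** Without the contribution of the starting point, the points on the spine
    solve y' = y/b + s with digits s <= r - 1; as b >= 2 r, the interval
    [0, r - 1/2] is stable under this recursion. *)
Lemma pushes_zeros_bounds (x : R) n :
  0 <= pushes t x (zeros hq n) - x / b%:R ^+ n <= r%:R - 2^-1.
Proof.
have r2 : 2 <= r%:R :> R by rewrite (ler_nat _ 2).
elim: n => [|n /andP[IH1 IH2]]; first by rewrite expr0 divr1 subrr lexx /=; lra.
have [s [sr e]] := zeros_digit n; rewrite (pushes_zerosS x e).
set y := pushes _ _ _ in IH1 IH2 *.
have shift (B P Y : R) : B != 0 -> P != 0 ->
  Y / B + s%:R - x / (B * P) = (Y - x / P) / B + s%:R.
  by move=> B0 P0; field; rewrite B0 P0.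
rewrite exprS shift ?expf_neq0 ?gt_eqF//.
set z := _ - _ in IH1 IH2 *.
have s1 : s%:R + 1 <= r%:R :> R by rewrite natr1 ler_nat.
have s0 : 0 <= s%:R :> R by [].
have z0 : 0 <= z / b%:R by rewrite divr_ge0// ltW.
have : z / b%:R <= 2^-1.
  rewrite ler_pdivrMr// natrM.
  have : 2 <= q%:R :> R by rewrite (ler_nat _ 2).
  by nra.
by move=> z1; apply/andP; split; lra.
Qed.

(** After a nonzero digit, the point y on the spine lies, up to 1/4, in
    [1, r - 1/2], so y/b lies in a compact subset of (0, 1/q) and the next
    factor is at most some c < 1.  A limit l of decreasing products that are
    multiplied by such a factor infinitely often satisfies l <= c l. *)
Lemma spine_irregular (x : R) :
  (forall K, exists2 n, (K <= n)%N & t (zeros hq n) <> 0) -> spine t x = 0.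
Proof.
move=> irr.
have r2 : 2 <= r%:R :> R by rewrite (ler_nat _ 2).
have q2 : 2 <= q%:R :> R by rewrite (ler_nat _ 2).
have b0 : b%:R != 0 :> R by rewrite gt_eqF.
have [|||c c1 hc] := @mask_lt1_on R q hq (3 / 4 / b%:R) ((r%:R - 4^-1) / b%:R).
- by rewrite divr_gt0//; lra.
- by rewrite ler_pM2r ?invr_gt0//; lra.
- have -> : (r%:R - 4^-1) / b%:R * q%:R = (r%:R - 4^-1) / r%:R :> R.
    by rewrite natrM; field; rewrite !pnatr_eq0; lia.
  by rewrite ltr_pdivrMr; lra.
(* the starting point is eventually forgotten *)
have small : \forall n \near \oo, `|x / b%:R ^+ n| <= 4^-1.
  have : x / b%:R ^+ n @[n --> \oo] --> 0.
    rewrite -[0](mulr0 x); apply: cvgM; first exact: cvg_cst.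
    under eq_fun do rewrite -exprVn.
    apply: cvg_expr; rewrite normrV ?unitfE// ger0_norm ?ltW//.
    by rewrite invf_lt1// (ltr_nat _ 1); nia.
  by move/cvgr0_norm_le; apply.
pose W n := weight t x (zeros hq n).
have drop n : (0 < n)%N -> `|x / b%:R ^+ n| <= 4^-1 -> t (zeros hq n) <> 0 ->
    W n.+1 <= c * W n.
  case: n => // n _ xs tn.
  have [s [_ e]] := zeros_digit n.
  have [s' [_ e']] := zeros_digit n.+1.
  rewrite /W zerosS weight_rcons mulrC.
  apply: ler_wpM2r; first exact: weight_ge0.
  have -> : push (subtree t (zeros hq n.+1))
      (pushes t x (zeros hq n.+1)) o =
      pushes t x (zeros hq n.+2) by rewrite [in RHS]zerosS pushes_cat.
  rewrite (pushes_zerosS x e') (maskDz q _ s').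
  apply: hc; rewrite !ler_pM2r ?invr_gt0//.
  have /andP[y1 y2] := pushes_zeros_bounds x n.+1.
  have /andP[y3 y4] := pushes_zeros_bounds x n.
  move: xs; rewrite ler_norml => /andP[x1 x2].
  apply/andP; split; last by lra.
  have : (1 : R) <= s%:R.
    by rewrite (ler_nat _ 1) lt0n; apply/eqP => s0; apply: tn; rewrite e s0 mulr0.
  have : 0 <= (pushes t x (zeros hq n) - x / b%:R ^+ n) / b%:R.
    by rewrite divr_ge0// ltW.
  have -> : pushes t x (zeros hq n.+1) =
    (pushes t x (zeros hq n) - x / b%:R ^+ n) / b%:R + s%:R
    + x / b%:R ^+ n.+1.
    have shift (B P Y : R) : B != 0 -> P != 0 ->
        Y / B + s%:R = (Y - x / P) / B + s%:R + x / (B * P).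
      by move=> B0 P0; field; rewrite B0 P0.
    by rewrite (pushes_zerosS x e) exprS; apply: shift; rewrite ?expf_neq0.
  by lra.
apply/eqP; rewrite eq_le spine_ge0// andbT leNgt; apply/negP => l0.
set l := spine _ _ in l0.
have c0 : 0 <= c.
  apply: le_trans (mask_ge0 q _) (hc (3 / 4 / b%:R) _).
  by rewrite lexx/= ler_pM2r ?invr_gt0//; lra.
(* (1 - c) l is chosen so that c (l + (1 - c) l) = (1 - (1 - c)^2) l < l *)
have close : \forall n \near \oo, W n < l + (1 - c) * l.
  have cW : cvgn W by exact: is_cvg_spine.
  apply: (cvgr_lt _ cW).
  by rewrite ltrDl mulr_gt0// subr_gt0.
have [K _ HK] : \forall n \near \oo, [/\ W n < l + (1 - c) * l,
    `|x / b%:R ^+ n| <= 4^-1 & (0 < n)%N].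
  by near=> n; split; near: n; [exact: close | exact: small | exists 1%N].
have [n Kn tn] := irr K; have [Wn xn n0] := HK n Kn.
have := drop n n0 xn tn; apply/negP; rewrite -ltNge.
have ln : l <= W n.+1 by exact: spine_le.
apply: lt_le_trans ln.
have : c * W n <= c * (l + (1 - c) * l) by rewrite ler_wpM2l// ltW.
have : 0 < (1 - c) * (1 - c) * l by rewrite !mulr_gt0// subr_gt0.
by lra.
Unshelve. all: by end_near. Qed.

End Irregular.

(** * Regularization preserves fullness *)
Section Regularization.
Variables (tau : word q -> int) (N : nat) (I : 'I_N -> word q).
Local Notation tauR := (regularized hq I tau).

Hypothesis ha : admissible b tau.

Let M := (\max_(i < N) size (I i)).+1.

Let ltM i : (size (I i) < M)%N.
Proof. by rewrite ltnS; exact: (leq_bigmax i). Qed.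

(** Compare the subtrees at a level M exceeding the lengths of all the I_i.
    Those rooted on a branch I_i 0^oo have the same subtrees off their spine;
    all others are equal. *)
Lemma full_regularized : full tau <-> full tauR.
Proof.
have haR := admissible_regularized hq hr I ha.
suff eqw w : size w = M ->
    full (subtree tau w) <-> full (subtree tauR w).
  split=> hf; apply: (@full_level M) => // w sw; apply/(eqw w sw);
    exact: full_subtree.
move=> sw.
have [[i [k [k1 wE]]]|off] :=
    pselect (exists i k, (1 <= k)%N /\ w = I i ++ zeros hq k).
  have off n a : a <> o -> subtree (subtree tauR w) (rcons (zeros hq n) a) =
                           subtree (subtree tau w) (rcons (zeros hq n) a).
    move=> ao; apply/funext => v; rewrite /subtree; apply: regularized_id.
    (* the nonzero letter a occurs at a position where I_j 0^l has a zero *)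
    move=> j l l1 /(congr1 (fun u => nth o u (size w + n))).
    rewrite nth_cat ltnNge leq_addr /= addKn nth_cat size_rcons size_nseq ltnSn.
    rewrite nth_rcons size_nseq ltnn eqxx nth_cat ltnNge sw.
    rewrite (leq_trans (ltnW (ltM j)) (leq_addr _ _))/=.
    by rewrite nth_nseq if_same.
  have aw : admissible b (subtree tau w) by exact: admissible_subtree.
  have awR : admissible b (subtree tauR w) by exact: admissible_subtree.
  split=> hf; apply: full_off_spine => // n a ao.
  - by rewrite off//; exact: full_subtree.
  - by rewrite -off//; exact: full_subtree.
suff -> : subtree tauR w = subtree tau w by [].
apply/funext => v; apply: regularized_id => i k k1 e; apply: off.
exists i, (M - size (I i))%N; rewrite subn_gt0 ltM; split=> //.
have := congr1 (take M) e; rewrite take_cat sw ltnn subnn take0 cats0 => ->.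
rewrite take_cat ltnNge ltnW//=; congr (_ ++ _).
have := congr1 size e; rewrite !size_cat sw size_nseq => e'.
rewrite /zeros take_nseq//; have := ltM i; lia.
Qed.

End Regularization.

(** * From branches to frequencies *)
Section Frequencies.
Variable mu : probability (measurableTypeR R) R.
Hypothesis hmu : self_similar q b mu.

Local Notation F x := (nsq (fourier mu x)).

Let b_gt1 : (1 < b)%N.
Proof. by nia. Qed.

(** The sum of the t(w|_k) b^(k-1) for 1 <= k <= |w|, in Horner form along
    the tree. *)
Fixpoint value t w : int :=
  if w is a :: v then t [:: a] + b%:Z * value (subtree t [:: a]) v else 0.

Lemma value_rcons t w a :
  value t (w ++ [:: a]) = value t w + b%:Z ^+ size w * t (w ++ [:: a]).
Proof.
elim: w t => [|c w IH] t /=; first by rewrite mulr0 addr0 add0r mul1r.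
by rewrite IH exprS /subtree /=; ring.
Qed.

(** Iterate the functional equation of the Fourier transform along w; the
    part of the frequency not yet read is an integer, invisible to the mask. *)
Lemma nsq_fourier_value t x w : F (x + r%:R * (value t w)%:~R) =
  weight t x w * F (pushes t x w).
Proof.
elim: w t x => [|a w IH] t x /=; first by rewrite mulr0 addr0 mul1r.
rewrite -mulrA -IH (nsq_fourier_self_similar hq hmu).
have -> : (x + r%:R * (t [:: a] + b%:Z * value (subtree t [:: a]) w)%:~R) / b%:R =
    push t x a + r%:R * (value (subtree t [:: a]) w)%:~R.
  rewrite /push intrD intrM natrM; field.
  by rewrite q_neq0 r_neq0.
congr (_ * _).
have -> : r%:R * (value (subtree t [:: a]) w)%:~R =
  (r%:Z * value (subtree t [:: a]) w)%:~R :> R by rewrite intrM.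
by rewrite maskDz.
Qed.

(** With zero digits the point after n letters is x/b^n, where the Fourier
    transform tends to 1. *)
Lemma spine_regular t x : (forall n, t (zeros hq n.+1) = 0) -> spine t x = F x.
Proof.
move=> t0.
have v0 n : value t (zeros hq n) = 0.
  by elim: n => // n IH; rewrite zerosS value_rcons IH -zerosS t0 mulr0.
have p0 n : pushes t x (zeros hq n) = x / b%:R ^+ n.
  elim: n => [|n IH]; first by rewrite expr0 divr1.
  rewrite (pushes_zerosS x (s := 0%N)) ?t0 ?mulr0// IH addr0 exprS invfM.
  by rewrite mulrA mulrAC.
have c1 : weight t x (zeros hq n) * F (x / b%:R ^+ n) @[n --> \oo]
    --> spine t x * 1.
  by apply: cvgM; [exact: is_cvg_spine | exact: nsq_fourier_cvg].
rewrite -[LHS]mulr1 -(cvg_lim _ c1)//; apply: cvg_lim => //.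
have -> : (fun n => weight t x (zeros hq n) * F (x / b%:R ^+ n)) = fun=> F x.
  by apply/funext => n; rewrite -p0 -nsq_fourier_value v0 mulr0 addr0.
exact: cvg_cst.
Qed.

Lemma iprefixS (s : iword q) n : iprefix s n.+1 = iprefix s n ++ [:: s n].
Proof. by rewrite /iprefix mkseqS cats1. Qed.

Lemma value_iprefix t s K n : (forall k, (K <= k)%N -> t (iprefix s k) = 0) ->
  (K <= n)%N -> value t (iprefix s n) = value t (iprefix s K).
Proof.
move=> h /subnKC <-; elim: (n - K)%N => [|k IH]; first by rewrite addn0.
rewrite addnS iprefixS value_rcons -iprefixS h ?mulr0 ?addr0//.
by rewrite -addnS leq_addr.
Qed.

Lemma Pi_map_value t s K : (forall k, (K <= k)%N -> t (iprefix s k) = 0) ->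
  Pi_map R b t s = (value t (iprefix s K))%:~R.
Proof.
move=> h; rewrite /Pi_map; apply: cvg_lim => //.
have part n : \sum_(1 <= k < n.+1) (t (iprefix s k))%:~R * b%:R ^+ k.-1 =
    (value t (iprefix s n))%:~R :> R.
  elim: n => [|n IH]; first by rewrite big_geq.
  rewrite [in RHS]iprefixS value_rcons -iprefixS intrD intrM -IH.
  by rewrite big_nat_recr//= size_mkseq rmorphXn /= mulrC.
apply: cvg_near_cst; exists K.+1 => // -[//|n] /= Kn.
by rewrite part (value_iprefix h).
Qed.

Fixpoint words n : seq (word q) :=
  if n is m.+1 then [seq a :: w | a <- enum 'I_q, w <- words m] else [:: [::]].

Lemma mem_words n w : (w \in words n) = (size w == n).
Proof.
elim: n w => [|n IH] [|a w] //=.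
  by apply/negbTE/negP => /allpairsP[[? ?] [_ _]].
rewrite eqSS -IH; apply/allpairsP/idP => [[[a' w'] [_ w'n [_ ->]]]//|wn].
by exists (a, w); split=> //; rewrite mem_enum.
Qed.

Lemma uniq_words n : uniq (words n).
Proof.
elim: n => //= n IH; apply: allpairs_uniq => //; first exact: enum_uniq.
by move=> [? ?] [? ?] _ _ [-> ->].
Qed.

Lemma mass_words n t x : mass n t x =
  \sum_(w <- words n) weight t x w *
    spine (subtree t w) (pushes t x w).
Proof.
elim: n t x => [|n IH] t x; first by rewrite /= big_seq1 mul1r.
rewrite /= big_allpairs_dep /= big_enum /=; apply: eq_bigr => a _.
by rewrite IH big_distrr /=; apply: eq_bigr => w _; rewrite mulrA.
Qed.

Definition frequency t w : R := r%:R * Pi_map R b t (pad0 hq w).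

Lemma frequency_value t w : regular_on t (pad0 hq w) ->
  exists K, forall k, (K <= k)%N ->
    frequency t w = r%:R * (value t (iprefix (pad0 hq w) k))%:~R.
Proof.
move=> /regular_onP[K hK]; exists K => k Kk; rewrite /frequency.
by rewrite (Pi_map_value (K := k))// => l kl; apply/hK/(leq_trans Kk).
Qed.

(** The probability of a branch w 0^oo is a squared Fourier coefficient if the
    mapping is regular on it, and zero otherwise. *)
Lemma spine_frequency t x w : admissible b t ->
  weight t x w * spine (subtree t w) (pushes t x w) =
  if `[< regular_on t (pad0 hq w) >] then F (x + frequency t w) else 0.
Proof.
move=> ht; case: asboolP => [reg|irr].
  have [K hK] := frequency_value reg; have [K' hK'] := (regular_onP _ _).1 reg.
  (* read enough zeros for all the remaining digits to vanish *)
  pose n := maxn K K'.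
  have pE m : iprefix (pad0 hq w) (size w + m) = w ++ zeros hq m.
    by rewrite iprefix_pad0 ?leq_addr// addKn.
  rewrite (hK (size w + n)%N); last by rewrite (leq_trans (leq_maxl K K'))// leq_addl.
  rewrite pE nsq_fourier_value weight_cat pushes_cat -mulrA; congr (_ * _).
  rewrite (spine_zeros _ _ n); congr (_ * _).
  apply: spine_regular => m; rewrite /subtree -zerosD -pE; apply: hK'.
  by rewrite (leq_trans (leq_maxr K K'))// addnCA leq_addr.
rewrite spine_irregular ?mulr0//; first exact: admissible_subtree.
move=> K; apply: contrapT => nex; apply: irr; apply/regular_onP.
exists (size w + K)%N => k Kk; apply: contrapT => tk; apply: nex.
exists (k - size w)%N; first by lia.
by rewrite /subtree -iprefix_pad0//; lia.
Qed.

Lemma mass_frequency n t x : admissible b t -> mass n t x =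
  \sum_(w <- words n | `[< regular_on t (pad0 hq w) >]) F (x + frequency t w).
Proof.
move=> ht; rewrite mass_words [RHS]big_mkcond /=.
by apply: eq_bigr => w _; rewrite spine_frequency.
Qed.

(** At the first letter where u and v differ, their digits are distinct modulo
    q, and the corresponding factor is the mask at an integer over q. *)
Lemma nsq_fourier_value_diff t u v : admissible b t ->
  size u = size v -> u <> v ->
  F (r%:R * (value t u - value t v)%:~R) = 0.
Proof.
elim: u t v => [|a u IH] t [|a' v] //= ht [suv] uv.
rewrite (nsq_fourier_self_similar hq hmu).
have [aa'|/eqP aa'] := eqVneq a a'.
  move: uv; rewrite -{}aa' => uv.
  rewrite (_ : _ / _ = r%:R * (value (subtree t [:: a]) u -
      value (subtree t [:: a]) v)%:~R); last first.
    by rewrite !(intrB, intrD, intrM) natrM /=; field; rewrite q_neq0 r_neq0.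
  rewrite [nsq _](IH (subtree t [:: a])) ?mulr0//; first exact: admissible_subtree.
  by move=> e; apply: uv; rewrite e.
rewrite [X in mask _ X](_ : _ = (t [:: a] - t [:: a'])%:~R / q%:R +
    (r%:Z * (value (subtree t [:: a]) u - value (subtree t [:: a']) v))%:~R); last first.
  by rewrite !(intrB, intrD, intrM) natrM /=; field; rewrite q_neq0 r_neq0.
rewrite maskDz mask_int_div ?mul0r// => /dvdzP[k].
have [[m /= hm] _] := ht [::] a; have [[m' /= hm'] _] := ht [::] a'.
rewrite hm hm' => e; apply/aa'/ord_eq_dvdz/dvdzP; exists (k - m + m').
by lia.
Qed.

Lemma frequency_orthogonal t w w' : admissible b t ->
  regular_on t (pad0 hq w) -> regular_on t (pad0 hq w') ->
  pad0 hq w <> pad0 hq w' -> F (frequency t w - frequency t w') = 0.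
Proof.
move=> ht /frequency_value[K hK] /frequency_value[K' hK'] ww'.
have [i wi] : exists i, pad0 hq w i <> pad0 hq w' i.
  apply: contrapT => h; apply: ww'; apply/funext => i.
  by apply: contrapT => ?; apply: h; exists i.
pose n := maxn (maxn K K') i.+1.
rewrite (hK n) ?(hK' n) ?/n; try by lia.
rewrite -mulrBr -intrB nsq_fourier_value_diff ?size_mkseq//.
move=> /(congr1 (fun u => nth o u i)).
by rewrite !nth_mkseq ?/n//; lia.
Qed.


Local Notation spectrum_of t := [set r%:R * l | l in (Lambda hq b t : set R)].

Lemma spectrum_ofP t (y : R) : spectrum_of t y <->
  exists w, regular_on t (pad0 hq w) /\ y = frequency t w.
Proof.
split=> [[_ [s [[w [_ ->]] reg] <-] <-]|[w [reg ->]]]; first by exists w.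
exists (Pi_map R b t (pad0 hq w)) => //; exists (pad0 hq w) => //.
by split=> //; exact: Gamma_pad0.
Qed.

Lemma frequency_zeros t w k :
  frequency t (w ++ zeros hq k) = frequency t w.
Proof. by rewrite /frequency pad0_zeros. Qed.

(** The frequencies carried by words of length n; these lists increase with n
    and exhaust r Lambda(t). *)
Definition frequencies n t : seq R :=
  [seq frequency t w |
    w <- [seq w <- words n | `[< regular_on t (pad0 hq w) >]]].

Lemma frequencies_spectrum n t l : l \in frequencies n t -> spectrum_of t l.
Proof.
move=> /mapP[w]; rewrite mem_filter => /andP[/asboolP reg _] ->.
by apply/spectrum_ofP; exists w.
Qed.

Lemma mem_frequencies t w n : regular_on t (pad0 hq w) -> (size w <= n)%N ->
  frequency t w \in frequencies n t.
Proof.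
move=> reg wn; apply/mapP; exists (w ++ zeros hq (n - size w)).
  rewrite mem_filter pad0_zeros mem_words size_cat size_nseq subnKC// eqxx andbT.
  exact/asboolP.
by rewrite frequency_zeros.
Qed.

Lemma spectrum_frequencies t (s : seq R) : (forall l, l \in s -> spectrum_of t l) ->
  exists n, forall l, l \in s -> l \in frequencies n t.
Proof.
elim: s => [|l s IH] hs; first by exists 0%N.
have [n hn] := IH (fun l' l's => hs l' (mem_behead (s := l :: s) l's)).
have /spectrum_ofP[w [reg lw]] := hs l (mem_head l s).
exists (maxn n (size w)) => l'; rewrite inE => /orP[/eqP ->|/hn].
  by rewrite lw mem_frequencies// leq_maxr.
move=> /mapP[v]; rewrite mem_filter mem_words => /andP[/asboolP vr /eqP vn] ->.
by apply: mem_frequencies => //; rewrite vn leq_maxl.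
Qed.

Lemma spectrum_orthogonal t l l' : admissible b t ->
  spectrum_of t l -> spectrum_of t l' -> l != l' -> nsq (fourier mu (l - l')) = 0.
Proof.
move=> ht /spectrum_ofP[w [wr ->]] /spectrum_ofP[w' [wr' ->]] ne.
apply: frequency_orthogonal => // e.
by move: ne; rewrite /frequency e eqxx.
Qed.

Lemma uniq_frequencies n t : admissible b t -> uniq (frequencies n t).
Proof.
move=> ht; rewrite map_inj_in_uniq ?filter_uniq ?uniq_words//.
move=> w w'; rewrite !mem_filter !mem_words.
move=> /andP[/asboolP wr /eqP wn] /andP[/asboolP wr' /eqP wn'] e.
have pp : pad0 hq w = pad0 hq w'.
  apply: contrapT => ne; have := frequency_orthogonal ht wr wr' ne.
  rewrite e subrr fourier0 nsqE /= expr1n expr0n addr0 => /eqP.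
  by rewrite oner_eq0.
apply: (@eq_from_nth _ o); first by rewrite wn wn'.
by move=> i _; have := congr1 (fun s => s i) pp.
Qed.

Lemma mass_sum_frequencies n t x : admissible b t -> mass n t x =
  \sum_(l <- frequencies n t) nsq (fourier mu (- x - l)).
Proof.
move=> ht; rewrite mass_frequency// big_map big_filter.
by apply: eq_bigr => w _; rewrite -opprD fourierN nsqJ.
Qed.

(** A polynomial involves finitely many frequencies, all carried by words of
    some length n, so by Pythagoras its squared distance to e_(-x) is at least
    1 - mass n, hence at least 1 - total. *)
Lemma approx_total t x : admissible b t ->
  approx mu (spectrum_of t) (fun y => chi (- x * y)) ->
  total t x = 1.
Proof.
move=> ht ax; apply/eqP; rewrite eq_le total_le1//= leNgt; apply/negP => t1.
have d0 : 0 < 1 - total t x by rewrite subr_gt0.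
have [s [sL ds]] := ax _ d0.
have [|n hn] := @spectrum_frequencies t [seq p.2 | p <- s].
  by move=> l /mapP[p /sL ? ->].
(* collect the coefficients of equal frequencies *)
pose e l := \sum_(p <- s | p.2 == l) p.1.
have uf := uniq_frequencies n ht.
have regroup : trigpoly s = trigpoly [seq (e l, l) | l <- frequencies n t].
  apply/funext => y; rewrite /trigpoly big_map /=.
  under [RHS]eq_bigr do rewrite /e big_distrl /= big_mkcond /=.
  rewrite exchange_big /=; apply: eq_big_seq => p ps.
  rewrite (bigD1_seq p.2)//=; last by apply/hn/map_f.
  rewrite eqxx big1 ?addr0// => l /negbTE lp.
  by rewrite eq_sym lp.
move: ds; rewrite regroup dist2_orthogonal//; last first.
  move=> l l' /frequencies_spectrum lL /frequencies_spectrum lL'.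
  exact: spectrum_orthogonal.
rewrite lte_fin -mass_sum_frequencies//; apply/negP; rewrite -leNgt.
have := mass_le_total n x ht.
have : 0 <= \sum_(l <- frequencies n t) nsq (fourier mu (- x - l) - e l).
  by apply: sumr_ge0 => l _; exact: nsq_ge0.
by lra.
Qed.

(** The projections onto the exponentials of word length n approximate
    e_(-x), since the squared distance 1 - mass n tends to 0. *)
Lemma total_approx t x : admissible b t -> total t x = 1 ->
  approx mu (spectrum_of t) (fun y => chi (- x * y)).
Proof.
move=> ht tx eps e0.
have cm : cvgn (fun n => mass n t x) by exact: is_cvg_total.
have [n _ hn] : \forall n \near \oo, 1 - eps < mass n t x.
  by apply: (cvgr_gt _ cm); rewrite -/(total t x) tx ltrBlDr ltrDl.
exists [seq (fourier mu (- x - l), l) | l <- frequencies n t]; split.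
  by move=> p /mapP[l ln ->]; exact: frequencies_spectrum ln.
rewrite (@dist2_orthogonal R mu _ _ (fun l => fourier mu (- x - l)))//; last 2 first.
- exact: uniq_frequencies.
- move=> l l' /frequencies_spectrum lL /frequencies_spectrum lL'.
  exact: spectrum_orthogonal.
rewrite -mass_sum_frequencies// big1 ?addr0; last by move=> l _; rewrite subrr nsq0.
by rewrite lte_fin; have := hn n (leqnn n); lra.
Qed.

(** Fullness gives the claim at irrational points only; the integer m is the
    limit of the irrational numbers m + pi/b^n. *)
Lemma full_approx_int t (m : int) : admissible b t ->
  full t -> approx mu (spectrum_of t) (fun y => chi (m%:~R * y)).
Proof.
move=> ht ft; apply: approx_closed; first exact: cmeasurable_chi.
move=> eps e0; have b1 : (1 < b)%N by nia.
pose y n : R := m%:~R + pi / b%:R ^+ n.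
have iy n : irrational (- y n).
  move=> [s _ sy]; apply: (@pi_irrationnal R).
  exists ((- s - m%:~R) * b%:R ^+ n) => //.
  rewrite rmorphM rmorphB rmorphN rmorphXn /= sy ratr_int ratr_nat opprK /y.
  by rewrite addrC addKr divfK// expf_neq0// pnatr_eq0; lia.
have c0 : 1 - nsq (fourier mu (- pi / b%:R ^+ n)) +
    nsq (fourier mu (- pi / b%:R ^+ n) - 1) @[n --> \oo] --> (1 - 1 + 0 : R).
  apply: cvgD; last exact: nsq_fourierB1_cvg.
  by apply: cvgB; [exact: cvg_cst | exact: nsq_fourier_cvg].
rewrite subrr addr0 in c0.
have [n _ hn] : \forall n \near \oo, 1 - nsq (fourier mu (- pi / b%:R ^+ n)) +
    nsq (fourier mu (- pi / b%:R ^+ n) - 1) < eps by exact: (cvgr_lt _ c0).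
exists (fun z => chi (- - y n * z)); split; first exact: cmeasurable_chi.
  by apply: total_approx => //; exact: ft.
have -> : (fun z => chi (- - y n * z)) = trigpoly [seq (1, l) | l <- [:: y n]].
  by apply/funext => z; rewrite /trigpoly big_map big_seq1 mul1r opprK.
rewrite (@dist2_orthogonal R mu _ _ (fun=> 1))//; last first.
  by move=> l l'; rewrite !inE => /eqP -> /eqP ->; rewrite eqxx.
rewrite !big_seq1; have -> : m%:~R - y n = - pi / b%:R ^+ n by rewrite /y opprD addNKr mulNr.
by rewrite lte_fin; exact: (hn n (leqnn n)).
Qed.

Lemma spectrum_int t l : spectrum_of t l -> exists m : int, l = m%:~R.
Proof.
move=> /spectrum_ofP[w [reg ->]]; have [K hK] := frequency_value reg.
rewrite (hK K)//; exists (r%:Z * value t (iprefix (pad0 hq w) K)).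
by rewrite intrM.
Qed.

Lemma countable_spectrum_of t : countable (spectrum_of t : set R).
Proof.
apply: (@sub_countable _ _ _
  ((fun w => frequency t w) @` [set: word q])).
  apply: subset_card_le => y /spectrum_ofP[w [_ ->]]; by exists w.
exact: sub_countable (card_image_le _ _) (countableP _).
Qed.

Lemma inner_expi2pi (l l' : R) :
  inner mu (expi2pi l) (expi2pi l') = fourier mu (l - l').
Proof.
rewrite /inner /fourier; congr cintegral; apply/funext => x.
by rewrite !expi2piE -chiN -chiD mulrBl.
Qed.

Lemma L2_expi2pi (l : R) : L2 mu (expi2pi l).
Proof.
have [mr mi] := cmeasurable_chi l; split.
- by under eq_fun do rewrite expi2piE; exact: mr.
- by under eq_fun do rewrite expi2piE; exact: mi.
under eq_integral do rewrite expi2piE -/(nsq _) nsq_chi.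
rewrite integral_cst//= mul1e.
by apply: (le_lt_trans (probability_le1 mu measurableT)); exact: ltry.
Qed.

(** Completeness passes from r Lambda(t) to r Lambda(t') by approximating the
    exponentials of the first family by those of the second. *)
Lemma spectrum_transfer t t' : admissible b t -> admissible b t' ->
  (full t -> full t') ->
  is_spectrum mu (spectrum_of t) -> is_spectrum mu (spectrum_of t').
Proof.
move=> ht ht' ff [_ [_ _ dense]].
have aL f : L2 mu f -> approx mu (spectrum_of t) f by move=> /dense/approxP.
have ft : full t.
  move=> x _; apply: approx_total => //.
  have := aL _ (L2_expi2pi (- x)); congr approx; apply/funext => y.
  by rewrite expi2piE.
split; first exact: countable_spectrum_of.
split.
- by move=> l _; exact: L2_expi2pi.
- move=> l l' lL lL'; rewrite inner_expi2pi; have [->|ne] := eqVneq l l'.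
    by rewrite subrr fourier0.
  exact/nsq_eq0/(spectrum_orthogonal ht').
- move=> f Lf; apply/approxP; apply: (approx_trans _ (aL f Lf)).
    by case: Lf.
  by move=> _ /spectrum_int[m ->]; exact: full_approx_int (ff ft).
Qed.

End Frequencies.

End Tree.

(** * Regularization preserves spectra *)

Unset Implicit Arguments.
Set Strict Implicit.

Theorem theorem2p10 (R : realType) (q r : nat) (hq : (1 < q)%N) (hr : (1 < r)%N)
  (mu : probability (measurableTypeR R) R)
  (hmu : self_similar q (q * r) mu)
  (tau : word q -> int) (htau : maximal_mapping hq (q * r) tau)
  (N : nat) (hN : (1 <= N)%N) (I : 'I_N -> word q)
  (hI : forall i, I i <> [::] /\ last_nonzero hq (I i))
  (hirr : [set s | Gamma hq s /\ ~ regular_on tau s] =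
          [set pad0 hq (I i) | i in [set: 'I_N]]) :
  spectral_mapping hq (q * r) r mu tau <->
  spectral_mapping hq (q * r) r mu (regularized hq I tau).
Proof.
have htauR := maximal_regularized hr htau hirr.
have ha := maximal_admissible htau; have haR := maximal_admissible htauR.
have ff := @full_regularized R q r hq hr tau N I ha.
split=> [[_ sp]|[_ sp]]; split=> //; apply: (spectrum_transfer hr hmu) sp => //.
- exact: ff.1.
- exact: ff.2.
Qed.
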